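(* Let $G$ be a connected simple graph with $v$ vertices, cyclomatic number $p_1=p_1(G)$, and containing exactly $t_3$ triangles. Then the chromatic graph homology $H_{i,j}(G)$ and chromatic graph cohomology $H^{i,j}(G)$ over the algebra $\mathcal{A}_2$ satisfy: (1) $H_{1,v-2}(G)\cong \mathbb{Z}_2^{p_1}$ if $G$ is bipartite, and $H_{1,v-2}(G)\cong \mathbb{Z}_2^{p_1-1}\oplus\mathbb{Z}$ if $G$ has an odd cycle. (2) $H_{2,v-2}(G)\cong \mathbb{Z}^{\binom{p_1}{2}-t_3}$ if $G$ is bipartite, and $H_{2,v-2}(G)\cong \mathbb{Z}^{\binom{p_1}{2}-t_3+1}$ if $G$ has an odd cycle. (3) $H^{1,v-2}(G)=0$ if $G$ is bipartite, and $H^{1,v-2}(G)\cong\mathbb{Z}$ if $G$ has an odd cycle. (4) $H^{2,v-2}(G)\cong \mathbb{Z}_2^{p_1}\oplus\mathbb{Z}^{\binom{p_1}{2}-t_3}$ if $G$ is bipartite, and $H^{2,v-2}(G)\cong \mathbb{Z}_2^{p_1-1}\oplus\mathbb{Z}^{\binom{p_1}{2}+1-t_3}$ if $G$ has an odd cycle.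
   Context: Graphs are finite. For a graph $G$ with vertex set $V(G)$ and edge set $E(G)$, put $v=|V(G)|$, let $p_0(G)$ be the number of connected components and $p_1(G)=|E(G)|-v+p_0(G)$ the cyclomatic number. $\mathbb{Z}_2=\mathbb{Z}/2\mathbb{Z}$. Let $\mathcal{A}_2=\mathbb{Z}[x]/(x^2)$ with basis $1,x$. Chromatic graph cohomology over $\mathcal{A}_2$: fix a linear order on $E(G)$. For $s\subseteq E(G)$ let $[G:s]$ be the spanning subgraph with vertex set $V(G)$ and edge set $s$. The cochain group $C^{i,j}(G)$ is the free abelian group on pairs consisting of a set $s\subseteq E(G)$ with $|s|=i$ and a labelling of the connected components of $[G:s]$ by $1$ or $x$ with exactly $j$ components labelled $x$ (so $\bigoplus_j C^{i,j}(G)=\bigoplus_{|s|=i}\mathcal{A}_2^{\otimes k(s)}$, with $k(s)$ the number of components of $[G:s]$). The differential $d:C^{i,j}(G)\to C^{i+1,j}(G)$ is $d=\sum_{e\in E(G)\setminus s}(-1)^{t(s,e)}d_e$ on the summand of $s$, where $t(s,e)$ is the number of edges of $s$ smaller than $e$, and $d_e$ maps to the summand of $s\cup\{e\}$: if $e$ joins two different components of $[G:s]$, the merged component gets the product in $\mathcal{A}_2$ of the two labels (the result is $0$ if both are $x$) and other labels are unchanged; if $e$ has both endpoints in one component of $[G:s]$, $d_e$ is the identity on labels. $H^{i,j}(G)$ is the cohomology of $(C^{*,j}(G),d)$ at $C^{i,j}(G)$. $H_{i,j}(G)$ is the homology of the dual chain complex $C_{i,j}(G)=\mathrm{Hom}(C^{i,j}(G),\mathbb{Z})$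 with the transposed differential $C_{i,j}(G)\to C_{i-1,j}(G)$. Both are independent of the order of edges. *)

(* Defs.v *)
From HB Require Import structures.
From mathcomp Require Import all_boot all_order all_algebra.
From mathcomp Require Import boolp.

Set Implicit Arguments.
Unset Strict Implicit.
Unset Printing Implicit Defensive.

Import GRing.Theory.
Local Open Scope ring_scope.

Definition zmod_iso (U V : zmodType) : Prop :=
  exists f : {additive U -> V}, bijective f.

Section Homology.
Variables (A B C : zmodType) (f : {additive A -> B}) (g : {additive B -> C}).

Definition cycle_pred : {pred B} := fun z => g z == 0.

Lemma cycle_pred_zmod_closed : zmod_closed cycle_pred.
Proof.
split=> [|x y]; rewrite !unfold_in ?raddf0 ?raddfB //.
by move=> /eqP -> /eqP ->; rewrite subr0.
Qed.
HB.instance Definition _ :=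
  GRing.isZmodClosed.Build B cycle_pred cycle_pred_zmod_closed.

Record cycles := Cycle { cycle_val : B; _ : cycle_val \in cycle_pred }.
HB.instance Definition _ := [isSub for cycle_val].
HB.instance Definition _ := [Choice of cycles by <:].
HB.instance Definition _ := [SubChoice_isSubZmodule of cycles by <:].

Definition boundary_pred : {pred cycles} :=
  fun z => `[< exists a, f a = cycle_val z >].

Lemma boundary_pred_zmod_closed : zmod_closed boundary_pred.
Proof.
split=> [|x y]; rewrite !unfold_in.
  by apply/asboolP; exists 0; rewrite raddf0.
move=> /asboolP[a fa] /asboolP[b fb].
by apply/asboolP; exists (a - b); rewrite raddfB fa fb.
Qed.
HB.instance Definition _ :=
  GRing.isZmodClosed.Build cycles boundary_pred boundary_pred_zmod_closed.

(* ker g modulo the elements of im f lying in it; all of im f when g \o f = 0 *)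
Definition homology : zmodType := {ideal_quot boundary_pred}.

End Homology.

Definition linear_order_on (U : finType) (D : {set U}) (le : rel U) : Prop :=
  [/\ {in D &, antisymmetric le}, {in D & &, transitive le}
    & {in D &, total le}].

Record sgraph := SGraph {
  vert :> finType;
  adj : rel vert;
  adj_sym : symmetric adj;
  adj_irrefl : irreflexive adj }.

Section Graph.
Variable G : sgraph.

Definition edges : {set {set G}} :=
  [set [set p.1; p.2] | p : G * G & adj p.1 p.2].

Definition span_adj (s : {set {set G}}) : rel G :=
  fun x y => (x != y) && ([set x; y] \in s).

Definition components (s : {set {set G}}) : {set {set G}} :=
  equivalence_partition (connect (span_adj s)) [set: G].

Definition p0 : nat := #|components edges|.

Definition p1 : nat := #|edges| + p0 - #|G|.

Definition connected : Prop := p0 = 1%N.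

Definition triangles : {set {set G}} :=
  [set A : {set G} | (#|A| == 3)
     && [forall x in A, forall y in A, (x != y) ==> adj x y]].

Definition t3 : nat := #|triangles|.

Definition bipartite : Prop :=
  exists c : G -> bool, forall x y, adj x y -> c x != c y.

Definition has_odd_cycle : Prop :=
  exists2 c : seq G, (2 < size c)%N && ucycleb (@adj G) c & odd (size c).

End Graph.

Section Chromatic.
Variables (G : sgraph) (le : rel {set G}).

(* A pair (s, X) stands for the edge set s together with the labelling of the
   components of [G:s] that puts x on the components in X and 1 on the others *)
Definition state : finType := ({set {set G}} * {set {set G}})%type.

Definition is_gen (i j : int) (b : state) : bool :=
  [&& b.1 \subset edges G, #|b.1|%:Z == i,
      b.2 \subset components b.1 & #|b.2|%:Z == j].

Definition gen (i j : int) : finType := {b : state | is_gen i j b}.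

Definition cochain (i j : int) : vectType int := {ffun gen i j -> int^o}.

Definition touched (s : {set {set G}}) (e : {set G}) : {set {set G}} :=
  [set K in components s | K :&: e != set0].

(* Labelling obtained from X by adding e to s; None is the zero of A_2.
   touched s e has one or two elements, and in the latter case cover merges
   them; the label of the result follows 1 * 1 = 1, 1 * x = x, x * x = 0. *)
Definition add_edge (s : {set {set G}}) (e : {set G}) (X : {set {set G}}) :
    option {set {set G}} :=
  let M := touched s e in
  if (#|M| <= 1)%N then Some X
  else if M \subset X then None
  else if [disjoint M & X] then Some X
  else Some (cover M |: (X :\: M)).

Definition pos (s : {set {set G}}) (e : {set G}) : nat :=
  #|[set e' in s | (e' != e) && le e' e]|.

Definition diff_coef (b b' : state) : int :=
  \sum_(e in edges G :\: b.1 | (e |: b.1 == b'.1)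
                               && (add_edge b.1 e b.2 == Some b'.2))
    (-1) ^+ pos b.1 e.

(* Zero unless i' = i + 1; a free target degree i' avoids casts between the
   types cochain (i - 1 + 1) j and cochain i j *)
Definition diff (i i' j : int) (z : cochain i j) : cochain i' j :=
  [ffun b' : gen i' j => \sum_(b : gen i j) z b * diff_coef (val b) (val b')].

Lemma diff_is_linear i i' j : linear (@diff i i' j).
Proof.
move=> a u w; apply/ffunP=> b'; rewrite !ffunE scaler_sumr -big_split /=.
by apply: eq_bigr => b _; rewrite !ffunE mulrDl -scalerAl.
Qed.
HB.instance Definition _ i i' j :=
  GRing.isLinear.Build int (cochain i j) (cochain i' j) *:%R (@diff i i' j)
    (@diff_is_linear i i' j).

Definition cohomology (i j : int) : zmodType :=
  homology (@diff (i - 1) i j) (@diff i (i + 1) j).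

Definition chain (i j : int) : vectType int := 'Hom(cochain i j, int^o).

Definition bdiff (i i' j : int) (phi : chain i j) : chain i' j :=
  (phi \o linfun (@diff i' i j))%VF.

Lemma bdiff_is_linear i i' j : linear (@bdiff i i' j).
Proof. by move=> a u w; rewrite /bdiff comp_lfunDl comp_lfunZl. Qed.
HB.instance Definition _ i i' j :=
  GRing.isLinear.Build int (chain i j) (chain i' j) *:%R (@bdiff i i' j)
    (@bdiff_is_linear i i' j).

Definition chomology (i j : int) : zmodType :=
  homology (@bdiff (i + 1) i j) (@bdiff i (i - 1) j).

End Chromatic.

(* Main.v *)
(** Since [v - 2] components must carry the label [x], the complex in degree
    [j = v - 2] is [C^0 -> C^1 -> C^2 -> C^3 -> 0], with [C^2 = Lambda^2 Z^E]
    and [C^3] free on the triangles.  The first map is injective with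
    torsion-free cokernel (propagate divisibility along paths), and the last one
    is split surjective (two edges determine a triangle), so everything reduces
    to the Smith normal form of the middle map [d].

    That form is read off from the number of elements killed by the transpose of
    [d] over [Z/N], for [N] prime and [N = 4].  Such an element is an alternating
    form [w] on [(Z/N)^E]; with [delta_u] the sum of the edges at [u], the
    condition is that [w(delta_u, e)] vanishes for [u] not in [e] and sums to [0]
    over the two ends of [e], i.e. that [D w = I diag(l)], where [D] and [I] are
    the unsigned and a signed incidence matrix.  Then [l] is a circulation, and
    in a basis of [Z^E] containing all but one of the [delta_u] the form [w] is
    determined by [l] and by an alternating form on the remaining [p1] basis
    vectors.  The last [delta_u] gives [2 l = 0] for a bipartite graph, and
    otherwise fixes twice one row of the remaining form. *)

Require Import Defs.
From HB Require Import structures.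
From mathcomp Require Import all_boot all_order all_algebra.
From mathcomp Require Import generic_quotient ring_quotient boolp.
From mathcomp Require Import zify ring.
Set Implicit Arguments.
Unset Strict Implicit.
Unset Printing Implicit Defensive.
Import GRing.Theory.

(** * Connected components of spanning subgraphs *)

(** Where the condition on [w] comes from: in the generator of [C^1] at the edge [e] whose component
    [K] carries the only label 1, adding an edge [f] multiplies [x] by [x] unless [f] meets [K]. The
    choice [K = {u}] gives [w(delta_u, e)]; for [K = e] one gets the sum over the two ends, since in
    a simple graph another edge meets [e] in at most one vertex. Counting spares an explicit Smith
    basis: over Z/N the kernel has N^corank times the product of the gcd(N, d_i) elements, and
    coordinates on alternating forms only have to be bijections of finite sets. The factor 2 is the
    obstacle. In the bipartite case the signed sum of the [delta_u] vanishes, while the same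
    combination of the rows of [I] is 2 or -2 on every edge. Otherwise the last [delta_u] is, modulo
    the others, twice a primitive vector, because all [delta_u] add up to twice the all-ones vector.
    As 2 may be a zero divisor in Z/N, identities that need a division by 2 or 4 are proved over the
    integers and then reduced. The free rank of [H_1] follows from the Euler characteristic. *)

Lemma cover_pair (T : finType) (A B : {set T}) : cover [set A; B] = A :|: B.
Proof.
apply/setP => x; apply/bigcupP/setUP => [[K]|].
  by rewrite !inE => /orP[] /eqP ->; [left|right].
by case=> xK; [exists A|exists B]; rewrite // !inE eqxx ?orbT.
Qed.

Section Components.
Variable G : sgraph.
Implicit Types (s : {set {set G}}) (e f K : {set G}) (x y : G).

Definition component s x : {set G} := [set y | connect (span_adj s) x y].

Lemma span_adj_sym s : symmetric (span_adj s).
Proof. by move=> x y; rewrite /span_adj eq_sym setUC. Qed.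

Lemma component_refl s x : x \in component s x.
Proof. by rewrite inE connect0. Qed.

Lemma component_eq s x y : y \in component s x -> component s y = component s x.
Proof.
rewrite inE => xy; apply/setP => z; rewrite !inE.
by rewrite (same_connect (sym_connect_sym (span_adj_sym s)) xy).
Qed.

Lemma componentsE s : components s = [set component s x | x : G].
Proof.
apply/setP => K; apply/imsetP/imsetP => -[x _ ->]; exists x => //.
  by apply/setP => y; rewrite !inE.
by apply/setP => y; rewrite !inE.
Qed.

Lemma component_components s x : component s x \in components s.
Proof. by rewrite componentsE imset_f. Qed.

Lemma componentsP s K : reflect (exists x, K = component s x) (K \in components s).
Proof. by rewrite componentsE; apply: (iffP imsetP) => [[x _ ->]|[x ->]]; exists x. Qed.

Lemma components_comp s K x : K \in components s -> x \in K -> K = component s x.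
Proof. by move=> /componentsP[y ->] /component_eq ->. Qed.

Lemma component_set0 x : component set0 x = [set x].
Proof.
apply/setP => y; rewrite !inE; apply/idP/eqP => [|->]; last exact: connect0.
have cl : closed (span_adj set0) (pred1 x).
  by move=> u v; rewrite /span_adj inE andbF.
by move/(closed_connect cl); rewrite !inE eqxx => /esym/eqP.
Qed.

(** The union of the components of [a] and [b] is closed under the new adjacency, and so is every
    old component that avoids both. *)
Lemma component_setU1 s a b x : a != b ->
  component ([set a; b] |: s) x =
    if x \in component s a :|: component s b
    then component s a :|: component s b else component s x.
Proof.
move=> nab; set U := component s a :|: component s b; set s' := [set a; b] |: s.
have sub u v : connect (span_adj s) u v -> connect (span_adj s') u v.
  apply: connect_sub => {}u {}v /andP[nuv uv]; apply: connect1.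
  by rewrite /span_adj nuv inE uv orbT.
have csym := sym_connect_sym (span_adj_sym s').
have ab : connect (span_adj s') a b.
  by apply: connect1; rewrite /span_adj nab !inE eqxx.
have Ua u : u \in U -> connect (span_adj s') a u.
  rewrite !inE => /orP[/sub//|/sub]; exact: connect_trans.
have clU : closed (span_adj s') (mem U).
  apply: intro_closed => // u v /andP[nuv]; rewrite in_setU1 => /orP[/eqP uv _|uv].
    have : v \in [set a; b] by rewrite -uv !inE eqxx orbT.
    by rewrite !inE => /orP[] /eqP ->; rewrite connect0 ?orbT.
  have uv' : connect (span_adj s) u v by apply: connect1; rewrite /span_adj nuv.
  by rewrite !inE => /orP[] /connect_trans -> //; rewrite ?orbT.
case: ifP => xU; apply/setP => y; rewrite inE.
  apply/idP/idP => [xy|/Ua ay]; first by rewrite -(closed_connect clU xy).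
  by apply: connect_trans ay; rewrite csym; apply: Ua.
rewrite [RHS]inE; apply/idP/idP => [xy|]; last exact: sub.
have cl : closed (span_adj s') (mem (component s x)).
  apply: intro_closed => // u v /andP[nuv]; rewrite in_setU1 => /orP[/eqP uv xu|uv].
    have : u \in U.
      have : u \in [set a; b] by rewrite -uv !inE eqxx.
      by rewrite !inE => /orP[] /eqP ->; rewrite connect0 ?orbT.
    move/negbT: xU; rewrite !inE negb_or in xu * => /andP[/negP na /negP nb].
    rewrite (sym_connect_sym (span_adj_sym s)) in xu.
    by case/orP => h; [case: na|case: nb]; apply: connect_trans xu.
  rewrite !inE => /connect_trans; apply.
  by apply: connect1; rewrite /span_adj nuv.
by have := closed_connect cl xy; rewrite !inE connect0 => <-.
Qed.

Lemma touched_pair s a b : touched s [set a; b] = [set component s a; component s b].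
Proof.
apply/setP => K; rewrite !inE; apply/andP/orP => [[Kc /set0Pn[x]]|].
  by rewrite !inE => /andP[xK /orP[]/eqP xe]; rewrite (components_comp Kc xK) xe eqxx; [left|right].
by case=> /eqP ->; rewrite component_components; split=> //; apply/set0Pn;
  [exists a|exists b]; rewrite inE component_refl !inE eqxx ?orbT.
Qed.

Lemma components_setU1 s a b : a != b ->
  components ([set a; b] |: s) =
    cover (touched s [set a; b]) |: (components s :\: touched s [set a; b]).
Proof.
move=> nab; rewrite touched_pair.
have -> : cover [set component s a; component s b] = component s a :|: component s b.
  exact: cover_pair.
apply/setP => K; apply/componentsP/idP => [[x ->]|].
  rewrite component_setU1 //; case: ifP => [_|/negbT]; first by rewrite !inE eqxx.
  rewrite inE negb_or => /andP[xa xb].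
  rewrite in_setU1 in_setD in_set2 component_components andbT negb_or; apply/orP; right.
  by apply/andP; split; [apply: contraNneq xa|apply: contraNneq xb] => <-; apply: component_refl.
rewrite in_setU1 => /orP[/eqP ->|].
  by exists a; rewrite component_setU1 // inE component_refl.
rewrite in_setD in_set2 negb_or => /andP[/andP[na nb] /componentsP[x xK]].
exists x; rewrite component_setU1 // inE ifN // negb_or.
rewrite xK in na nb; apply/andP; split.
  by apply: contraNN na => /component_eq ->.
by apply: contraNN nb => /component_eq ->.
Qed.

(** The components touched by the edge are replaced by their union. There are one or two of them,
    according to whether the edge closes a cycle. *)
Lemma card_components_setU1 s a b : a != b ->
  #|components ([set a; b] |: s)| + #|touched s [set a; b]| = (#|components s|).+1.
Proof.
move=> nab; rewrite components_setU1 // cardsU1.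
(* A component equal to the union would contain [a], hence be one of the touched components that
   were removed. *)
have -> : cover (touched s [set a; b]) \notin components s :\: touched s [set a; b].
  rewrite inE negb_and negbK orbC; have [h|//] := boolP (_ \in components s).
  suff -> : cover (touched s [set a; b]) = component s a by rewrite touched_pair !inE eqxx.
  apply: components_comp => //; rewrite touched_pair cover_pair.
  by rewrite inE component_refl.
have sub : touched s [set a; b] \subset components s.
  by apply/subsetP => K; rewrite inE => /andP[].
have := cardsID (touched s [set a; b]) (components s).
rewrite (setIidPr sub); lia.
Qed.

End Components.

Section Edges.
Variable G : sgraph.
Implicit Types (s : {set {set G}}) (e f K : {set G}) (x y : G).

Lemma edgesP e : reflect (exists x y, adj x y /\ e = [set x; y]) (e \in edges G).
Proof.
apply: (iffP imsetP) => [[[x y] /=]|[x [y [xy ->]]]]; last by exists (x, y); rewrite ?inE.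
by rewrite inE => xy ->; exists x, y.
Qed.

Lemma adj_neq x y : adj x y -> x != y.
Proof. by apply: contraTneq => ->; rewrite adj_irrefl. Qed.

Lemma edge_pair e : e \in edges G -> exists x y, x != y /\ e = [set x; y].
Proof. by move=> /edgesP[x [y [/adj_neq nxy ->]]]; exists x, y. Qed.

Lemma card_edge e : e \in edges G -> #|e| = 2.
Proof. by move=> /edge_pair[x [y [nxy ->]]]; rewrite cards2 nxy. Qed.

Lemma edge_adj x y : [set x; y] \in edges G -> x != y -> adj x y.
Proof.
move=> /edgesP[u [v [uv e]]] nxy.
have : x \in [set u; v] by rewrite -e !inE eqxx.
have : y \in [set u; v] by rewrite -e !inE eqxx orbT.
rewrite !inE => /orP[]/eqP ey /orP[]/eqP ex; move: nxy uv; rewrite ex ey ?eqxx //.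
by rewrite adj_sym.
Qed.

Lemma connected_invariant (Q : pred G) : connected G ->
  (forall x y, adj x y -> Q x -> Q y) -> forall x y, Q x -> Q y.
Proof.
move=> Gc QS x y Qx; have : connect (span_adj (edges G)) x y.
  have : component (edges G) x = component (edges G) y.
    have /eqP/cards1P[K eK] := Gc.
    have := component_components (edges G) x; have := component_components (edges G) y.
    by rewrite eK !inE => /eqP -> /eqP ->.
  by move/setP/(_ y); rewrite component_refl inE.
have cl : closed (span_adj (edges G)) Q.
  apply: intro_closed; first exact: sym_connect_sym (span_adj_sym _).
  by move=> u v /andP[nuv /edge_adj/(_ nuv)]; apply: QS.
by move=> xy; have := closed_connect cl xy; rewrite -!topredE /= Qx => <-.
Qed.

Lemma card_components0 : #|components (set0 : {set {set G}})| = #|G|.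
Proof.
rewrite componentsE card_imset // => x y; rewrite !component_set0 => /set1_inj.
exact.
Qed.

Lemma component_edge e x : e \in edges G -> component [set e] x = if x \in e then e else [set x].
Proof.
move=> /edge_pair[a [b [nab ->]]]; rewrite -[[set _]]setU0 component_setU1 // !component_set0.
by rewrite !inE.
Qed.

(** Two distinct edges of a simple graph never close a cycle, since they share at most one
    vertex. *)
Lemma touched_edge e f : e \in edges G -> f \in edges G -> f != e -> #|touched [set e] f| = 2.
Proof.
move=> eE /[dup] fE /edge_pair[a [b [nab ef]]] nfe; rewrite {1}ef touched_pair cards2.
suff -> : component [set e] a != component [set e] b by [].
rewrite !component_edge //; case: ifP => ae; case: ifP => be.
- case/negP: nfe; rewrite eqEcard !card_edge // leqnn andbT.
  by rewrite ef; apply/subsetP => x; rewrite !inE => /orP[] /eqP ->.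
- by apply: contraFneq be => ->; rewrite inE.
- by apply: contraFneq ae => <-; rewrite inE.
by apply: contraNneq nab => /set1_inj ->.
Qed.

Lemma card_components1 e : e \in edges G -> (#|components [set e]|).+1 = #|G|.
Proof.
move=> /edge_pair[a [b [nab ->]]]; rewrite -[[set _]]setU0 -card_components0.
have := card_components_setU1 set0 nab; rewrite touched_pair cards2 !component_set0.
by rewrite (inj_eq set1_inj) nab addn2 => -[].
Qed.

Lemma card_components2 e f : e \in edges G -> f \in edges G -> f != e ->
  (#|components (f |: [set e])|).+2 = #|G|.
Proof.
move=> eE /[dup] fE /edge_pair[a [b [nab ef]]] nfe.
have := card_components_setU1 [set e] nab; rewrite -ef touched_edge //.
by rewrite -(card_components1 eE); lia.
Qed.

Lemma components_add s e : e \in edges G ->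
  components (e |: s) = cover (touched s e) |: (components s :\: touched s e).
Proof. by move=> /edge_pair[a [b [nab ->]]]; apply: components_setU1. Qed.

Lemma card_components_add s e : e \in edges G ->
  #|components (e |: s)| + #|touched s e| = (#|components s|).+1.
Proof. by move=> /edge_pair[a [b [nab ->]]]; apply: card_components_setU1. Qed.

Lemma components_add_inner s e : e \in edges G -> #|touched s e| <= 1 ->
  components (e |: s) = components s.
Proof.
move=> /edge_pair[a [b [nab ->]]]; rewrite components_setU1 // touched_pair cover_pair.
rewrite cards2; case: eqP => // -> _; rewrite !setUid setD1K //.
exact: component_components.
Qed.

Lemma mem_touched s e K : K \in components s -> (K \in touched s e) = (K :&: e != set0).
Proof. by move=> Kc; rewrite inE Kc. Qed.

Lemma components_card2 s : s \subset edges G -> #|s| = 2 -> (#|components s|).+2 = #|G|.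
Proof.
move=> sE /eqP/cards2P[f [e [nef es]]]; rewrite es; apply: card_components2 => //.
all: by apply: (subsetP sE); rewrite es !inE eqxx ?orbT.
Qed.

(* Both [f] and [g] close up the same two components of [[G : {e}]]. *)
Lemma touched_inner e f g : e \in edges G -> f \in edges G -> g \in edges G ->
  f != e -> g != e -> #|touched (f |: [set e]) g| <= 1 ->
  touched [set e] g = touched [set e] f.
Proof.
move=> eE fE gE nfe nge tg; have t2 := touched_edge eE gE nge.
have [c [d [ncd eg]]] := edge_pair gE; have [a [b [nab ef]]] := edge_pair fE.
have tf := touched_edge eE fE nfe.
apply/eqP; rewrite eqEcard t2 tf leqnn andbT.
have ncd' : component [set e] c != component [set e] d.
  by move: t2; rewrite eg touched_pair cards2; case: eqVneq.
have : component (f |: [set e]) c = component (f |: [set e]) d.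
  by move: tg; rewrite eg touched_pair cards2; case: eqVneq.
rewrite eg ef !component_setU1 // !touched_pair.
set A := component _ a; set B := component _ b.
case: ifP => cAB; case: ifP => dAB e1.
- apply/subsetP => K; rewrite !inE => /orP[] /eqP ->.
    by move: cAB; rewrite inE => /orP[] /component_eq ->; rewrite eqxx ?orbT.
  by move: dAB; rewrite inE => /orP[] /component_eq ->; rewrite eqxx ?orbT.
- by move: dAB; rewrite e1 component_refl.
- by move: cAB; rewrite -e1 component_refl.
by rewrite e1 eqxx in ncd'.
Qed.

End Edges.

(** * Generators and matrix coefficients in degree v - 2 *)

Section States.
Variable G : sgraph.
Implicit Types (s : {set {set G}}) (e f K P : {set G}) (x y : G) (b : state G).

Local Notation J := (#|G|%:Z - 2)%R.

(* Generators of degree [v - 2] in [C^0] and [C^1] have all components labelled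
   [x], except the two vertices of [P] and the component [K]; in [C^2] and [C^3]
   all components are labelled [x]. *)
Definition state0 P : state G := (set0, [set [set x] | x in ~: P]).
Definition state1 e K : state G := ([set e], components [set e] :\ K).
Definition state2 s : state G := (s, components s).

Lemma is_genE k b : is_gen k%:Z J b =
  [&& b.1 \subset edges G, #|b.1| == k, b.2 \subset components b.1 & #|b.2| + 2 == #|G|].
Proof. by rewrite /is_gen eqz_nat; congr [&& _, _, _ & _]; apply/eqP/eqP; lia. Qed.

Lemma components0 : components (set0 : {set {set G}}) = [set [set x] | x : G].
Proof. by rewrite componentsE; apply: eq_imset => x; rewrite component_set0. Qed.

Lemma is_gen0P b : reflect (exists2 P : {set G}, #|P| = 2 & b = state0 P) (is_gen 0 J b).
Proof.
rewrite is_genE; apply: (iffP and4P) => [[_]|[P P2 ->] /=].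
  case: b => s X /=; rewrite cards_eq0 => /eqP -> sX /eqP cX.
  rewrite components0 in sX.
  have XE : X = [set [set x] | x in [set x | [set x] \in X]].
    apply/setP => K; apply/idP/imsetP => [KX|[x]]; last by rewrite inE => xX ->.
    by have /imsetP[x _ eK] := subsetP sX _ KX; exists x; rewrite // inE -eK.
  exists (~: [set x | [set x] \in X]); last by rewrite /state0 setCK -XE.
  have := cardsC [set x | [set x] \in X].
  rewrite XE card_imset in cX; last exact: set1_inj.
  by rewrite -cX => /addnI.
split; rewrite ?sub0set ?cards0 //.
  by rewrite components0; apply/subsetP => K /imsetP[x _ ->]; apply: imset_f.
rewrite card_imset; last exact: set1_inj.
by rewrite cardsCs setCK P2 subnK // -P2 max_card.
Qed.

Lemma is_gen1P b : reflect (exists e K : {set G}, [/\ e \in edges G, K \in components [set e]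
  & b = state1 e K]) (is_gen 1 J b).
Proof.
rewrite is_genE; apply: (iffP and4P) => [[]|[e [K [eE Kc ->]]] /=].
  case: b => s X /= sE /cards1P[e es]; rewrite {s}es in sE *.
  rewrite sub1set in sE => sX /eqP cX.
  have : #|components [set e] :\: X| = 1.
    rewrite cardsD (setIidPr sX); move: cX.
    by rewrite -(card_components1 sE) addn2 => -[<-]; rewrite subSnn.
  move/eqP/cards1P=> [K eK]; exists e, K; split=> //.
    by have : K \in components [set e] :\: X; [rewrite eK set11|rewrite inE => /andP[]].
  by rewrite /state1 -eK setDDr setDv set0U (setIidPr sX).
split; rewrite ?sub1set ?cards1 ?subsetDl //.
by rewrite -(card_components1 eE) (cardsD1 K (components _)) Kc addn2 add1n.
Qed.

Lemma is_gen2P b : reflect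
  (exists s : {set {set G}}, [/\ s \subset edges G, #|s| = 2 & b = state2 s])
  (is_gen 2 J b).
Proof.
rewrite is_genE; apply: (iffP and4P) => [[]|[s [sE s2 ->]] /=].
  case: b => s X /= sE /eqP s2 sX /eqP cX; exists s; split=> //; congr (_, _).
  by apply/eqP; rewrite eqEcard sX -(leq_add2r 2) cX -(components_card2 sE s2) addn2 leqnn.
split=> //; first by rewrite s2.
by rewrite -(components_card2 sE s2) addn2.
Qed.

(** Two edges already bring the number of components down to [v - 2], so the third may not lower it:
    each edge of [s] closes a cycle with the other two. *)
Lemma gen3_components s e : s \subset edges G -> #|s| = 3 -> #|G| <= #|components s| + 2 ->
  e \in s -> #|touched (s :\ e) e| = 1 /\ #|components s| + 2 = #|G|.
Proof.
move=> sE s3 cs es; have eE := subsetP sE _ es.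
have s2 : #|s :\ e| = 2 by move: s3; rewrite (cardsD1 e) es => -[].
have c2 := components_card2 (subset_trans (subsetDl _ _) sE) s2.
have := card_components_add (s :\ e) eE; rewrite setD1K //.
suff : 0 < #|touched (s :\ e) e| by lia.
have [x [y [_ ->]]] := edge_pair eE; rewrite touched_pair card_gt0.
by apply/set0Pn; exists (component (s :\ [set x; y]) x); rewrite !inE eqxx.
Qed.

Lemma is_gen3P b : reflect (exists s : {set {set G}}, [/\ s \subset edges G, #|s| = 3,
    #|components s| + 2 = #|G| & b = state2 s]) (is_gen 3 J b).
Proof.
rewrite is_genE; apply: (iffP and4P) => [[]|[s [sE s3 cs ->]] /=]; last first.
  by split=> //; apply/eqP.
case: b => s X /= sE /eqP s3 sX /eqP cX.
have cs := subset_leq_card sX.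
have [e es] : exists e, e \in s by apply/set0Pn; rewrite -card_gt0 s3.
have [|_ c3] := gen3_components sE s3 _ es; first by rewrite -cX leq_add2r.
exists s; split=> //; congr (_, _); by apply/eqP; rewrite eqEcard sX -(leq_add2r 2) cX c3 leqnn.
Qed.

Variable le : rel {set G}.
Hypothesis le_order : linear_order_on (edges G) le.

Definition edge_sign s e : int := ((-1) ^+ pos le s e)%R.

Lemma diff_coef_sub0 b b' : ~~ (b.1 \subset b'.1) -> diff_coef le b b' = 0%R.
Proof.
move=> nsub; apply: big1 => e /andP[_ /andP[/eqP eb _]].
by rewrite -eb subsetUr in nsub.
Qed.

Lemma diff_coef_add b b' e : e \in edges G -> e \notin b.1 -> b'.1 = e |: b.1 ->
  diff_coef le b b' = ((add_edge b.1 e b.2 == Some b'.2)%:R * edge_sign b.1 e)%R.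
Proof.
move=> eE neb eb; rewrite /diff_coef eb.
have uniq_e e' : e' \notin b.1 -> (e' |: b.1 == e |: b.1) = (e' == e).
  move=> ne'b; apply/eqP/eqP => [/setP/(_ e')|-> //].
  by rewrite !in_setU1 eqxx (negbTE ne'b) !orbF => /esym/eqP.
case h : (add_edge b.1 e b.2 == Some b'.2).
  rewrite (big_pred1 e) ?mul1r // => e'; rewrite !inE.
  apply/idP/idP => [/andP[/andP[ne'b _] /andP[]]|/eqP ->]; first by rewrite uniq_e.
  by rewrite neb eE eqxx.
rewrite mul0r; apply: big1 => e'; rewrite inE => /andP[/andP[ne'b _] /andP[]].
by rewrite uniq_e // => /eqP -> ; rewrite h.
Qed.

Lemma pos_setU1 s e f : e \in edges G -> f \in edges G -> e \notin s -> e != f ->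
  pos le (e |: s) f = le e f + pos le s f.
Proof.
move=> eE fE es nef; rewrite /pos.
have -> : [set e' in e |: s | (e' != f) && le e' f] =
   (if le e f then [set e] else set0) :|: [set e' in s | (e' != f) && le e' f].
  apply/setP => e'; rewrite !inE; have [->|ne] := eqVneq e' e.
    by rewrite nef (negbTE es) /=; case: (le e f); rewrite ?inE ?eqxx.
  by case: (le e f); rewrite ?inE ?(negbTE ne).
case: (le e f); rewrite ?set0U // cardsU1 !inE (negbTE es) /=.
by [].
Qed.

Lemma le_asym e f : e \in edges G -> f \in edges G -> e != f -> le f e = ~~ le e f.
Proof.
move=> eE fE nef; have [asym _ tot] := le_order.
have := tot e f eE fE; case ef: (le e f); case fe: (le f e) => //= _.
by move: nef; rewrite (asym e f) ?eqxx // ef fe.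
Qed.

(** Exactly one of [e], [f] precedes the other, and it adds one inversion in only one of the two
    orders. Every cancellation in [d d = 0] uses this sign. *)
Lemma edge_sign_swap s e f : e \in edges G -> f \in edges G -> e \notin s -> f \notin s ->
  e != f ->
  (edge_sign s e * edge_sign (e |: s) f = - (edge_sign s f * edge_sign (f |: s) e))%R.
Proof.
move=> eE fE es fs nef; rewrite /edge_sign !pos_setU1 // 1?eq_sym // -!exprD.
rewrite (le_asym eE fE nef) addnCA (addnCA (pos le s f)) [pos le s f + _]addnC.
by rewrite !exprD; case: (le e f); rewrite /= ?expr0 ?expr1; lia.
Qed.

Lemma edge_sign1_swap e f : e \in edges G -> f \in edges G -> e != f ->
  (edge_sign [set f] e = - edge_sign [set e] f)%R.
Proof.
move=> eE fE nef; have := edge_sign_swap (s := set0) eE fE; rewrite !inE => /(_ isT isT nef).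
rewrite !setU0 /edge_sign /pos.
have p0 g : [set e' in set0 | (e' != g) && le e' g] = set0 by apply/setP => h; rewrite !inE.
by rewrite !p0 cards0 !expr0 !mul1r => ->; rewrite opprK.
Qed.

End States.

Section Coefficients.
Variables (G : sgraph) (le : rel {set G}).
Implicit Types (s : {set {set G}}) (e f K P : {set G}) (x y : G).

(** The edge [f] merges two components. If neither is [K], both carry [x] and the product is 0; if
    one is [K], the product is [1 x = x] and everything is labelled [x]. *)
Lemma diff_coef12 e f K : e \in edges G -> f \in edges G -> f != e ->
  K \in components [set e] ->
  diff_coef le (state1 e K) (state2 (f |: [set e])) =
    ((K :&: f != set0)%:R * edge_sign le [set e] f)%R.
Proof.
move=> eE fE nfe Kc; rewrite (diff_coef_add le (e := f)) ?inE // /=; congr (_%:R * _)%R.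
rewrite /add_edge touched_edge //= -(mem_touched f Kc).
set M := touched _ _; have M2 : #|M| = 2 by apply: touched_edge.
have Mc : M \subset components [set e] by apply/subsetP => L; rewrite inE => /andP[].
have -> : (M \subset components [set e] :\ K) = (K \notin M).
  by rewrite subsetD1 Mc.
have [KM|//] := boolP (K \in M); rewrite /=.
have -> : [disjoint M & components [set e] :\ K] = false.
  apply/negbTE; have : #|M :\ K| = 1 by have := M2; rewrite (cardsD1 K) KM => -[].
  move/eqP/cards1P => [L eL]; have : L \in M :\ K by rewrite eL set11.
  rewrite in_setD1 => /andP[nLK LM].
  apply/negP => /pred0P/(_ L) /=; rewrite LM in_setD1 nLK /=.
  by rewrite (subsetP Mc).
have -> : components [set e] :\ K :\: M = components [set e] :\: M.
  by rewrite setDDl (setUidPr _) // sub1set.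
by rewrite components_add // -/M eqxx.
Qed.

Lemma diff_coef23 s e : e \in edges G -> e \notin s -> #|touched s e| <= 1 ->
  diff_coef le (state2 s) (state2 (e |: s)) = edge_sign le s e.
Proof.
move=> eE es t1; rewrite (diff_coef_add le (e := e)) // /add_edge t1 /=.
by rewrite components_add_inner // eqxx mul1r.
Qed.

(** Three cases: if [e] misses [P], two labels [x] are multiplied and give 0; if [e = P], the merged
    component [e] has label 1; if they share one vertex, the merged component has label [x] and the
    other vertex of [P] keeps its 1. The sign is trivial as no edge is present before [e]. *)
Lemma diff_coef01 e K P : e \in edges G -> K \in components [set e] -> #|P| = 2 ->
  diff_coef le (state0 P) (state1 e K) =
    ((P :&: e != set0) && (K == if P == e then e else P :\: e))%:R%R.
Proof.
move=> eE Kc P2; rewrite (diff_coef_add le (e := e)) ?inE ?setU0 //=.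
rewrite /edge_sign /pos (_ : [set e' in _ | _] = set0); last by apply/setP => h; rewrite !inE.
rewrite cards0 expr0 mulr1; congr (_%:R)%R.
have [a [b [nab eab]]] := edge_pair eE.
have tE : touched set0 e = [set [set a]; [set b]].
  by rewrite eab touched_pair !component_set0.
have mX x : ([set x] \in [set [set y] | y in ~: P]) = (x \notin P).
  by rewrite (mem_imset _ _ (@set1_inj G)) inE.
set X := [set [set y] | y in ~: P] in mX *.
have compE : components [set e] = e |: (components set0 :\: touched set0 e).
  rewrite -{1}[[set e]]setU0 components_add //; congr (_ |: _).
  by rewrite tE cover_pair eab.
have c0E L : (L \in components (set0 : {set {set G}})) = (#|L| == 1).
  rewrite components0; apply/imsetP/cards1P => [[x _ ->]|[x ->]]; by exists x.
have XE L : (L \in X) = (#|L| == 1) && [disjoint L & P].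
  apply/imsetP/andP => [[x]|[/cards1P[x ->]]].
    by rewrite inE => xP ->; rewrite cards1 disjoints1.
  by rewrite disjoints1 => xP; exists x; rewrite // inE.
have tL L : (L \in touched set0 e) = (#|L| == 1) && (L \subset e).
  rewrite tE; apply/idP/andP => [|[/cards1P[x ->]]].
    by rewrite !inE => /orP[]/eqP ->; rewrite cards1 sub1set eab !inE !eqxx ?orbT.
  by rewrite sub1set eab !inE => /orP[]/eqP ->; rewrite eqxx ?orbT.
have KI L L' : L \in components [set e] -> L' \in components [set e] ->
   (components [set e] :\ L == components [set e] :\ L') = (L == L').
  move=> Lc L'c; apply/eqP/eqP => [/setP/(_ L)|-> //].
  by rewrite !in_setD1 eqxx Lc !andbT => /esym/negbFE/eqP.
have e2 := card_edge eE.
rewrite /add_edge tE cards2 (inj_eq set1_inj) nab /=.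
have subE : ([set [set a]; [set b]] \subset X) = (P :&: e == set0).
  rewrite subUset !sub1set !mX eab; apply/andP/eqP => [[aP bP]|].
    apply/setP => x; rewrite !inE; apply/negP => /andP[xP /orP[]/eqP ex].
      by rewrite -ex xP in aP.
    by rewrite -ex xP in bP.
  move=> /setP h; have := h a; have := h b; rewrite !inE !eqxx orbT !andbT.
  by move=> -> ->.
have disE : [disjoint [set [set a]; [set b]] & X] = (P == e).
  rewrite disjoints_subset subUset !sub1set !in_setC !mX !negbK; apply/andP/eqP => [[aP bP]|->].
    by apply/esym/eqP; rewrite eqEcard e2 P2 leqnn andbT eab subUset !sub1set aP.
  by rewrite eab !inE !eqxx orbT.
rewrite subE disE -tE.
have ec : e \in components [set e] by rewrite compE setU11.
have cE L : (L \in components [set e]) = (L == e) || (#|L| == 1) && ~~ (L \subset e).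
  rewrite compE in_setU1 in_setD c0E tL.
  by case: (L == e); case: (#|L| == 1); rewrite /= ?andbT ?andbF.
have ne1 x : ([set x] == e) = false by apply/negbTE; apply/eqP => h; have := e2; rewrite -h cards1.
have [//|Pe] := eqVneq (P :&: e) set0; rewrite /=.
have [ePe|nPe] := eqVneq P e.
  rewrite eq_sym -(KI K e) // (_ : X = components [set e] :\ e) //.
  apply/setP => L; rewrite XE in_setD1 cE ePe; case: (eqVneq L e) => [->|_] /=; first by rewrite e2.
  by case: eqP => // /eqP/cards1P[x ->]; rewrite disjoints1 sub1set.
have [c Pc] : exists c, P :\: e = [set c].
  apply/cards1P; rewrite cardsD P2 eqn_leq; apply/andP; split.
    by rewrite leq_subLR addn1 ltnS card_gt0.
  rewrite subn_gt0 -P2 ltn_neqAle subset_leq_card ?subsetIl // andbT.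
  apply: contraNneq nPe => h; apply/eqP/eqP; rewrite eqEcard e2 P2 leqnn andbT.
  by apply/setIidPl/eqP; rewrite eqEcard subsetIl h leqnn.
have ce : c \notin e by have : c \in P :\: e; [rewrite Pc set11|rewrite inE => /andP[]].
have cc : [set c] \in components [set e] by rewrite cE cards1 sub1set ce orbT.
rewrite Pc eq_sym -(KI K [set c]) // (_ : cover _ |: _ = components [set e] :\ [set c]) //.
rewrite {1}tE cover_pair -eab; apply/setP => L.
rewrite in_setU1 in_setD in_setD1 XE tL cE; case: (eqVneq L e) => [->|_] /=.
  by rewrite eq_sym ne1.
case: eqP => [/eqP/cards1P[x ->]|_]; last by rewrite /= !andbF.
have /setP/(_ x) := Pc; rewrite sub1set disjoints1 (inj_eq set1_inj) !inE.
move: (x \in e) (x \in P) (x == c).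
by do 3 case.
Qed.

End Coefficients.

Lemma sum_enum_val (R : nmodType) (T : finType) (F : T -> R) :
  (\sum_(i < #|T|) F (enum_val i) = \sum_x F x)%R.
Proof.
rewrite [RHS](reindex (@enum_val T predT)) //=.
by apply: onW_bij; apply: enum_val_bij.
Qed.

Lemma sum_sig (R : nmodType) (T : finType) (P : pred T) (F : T -> R) :
  (\sum_(b : {x | P x}) F (val b) = \sum_(x | P x) F x)%R.
Proof.
rewrite [RHS](reindex_omap (val : {x | P x} -> T) insub); last first.
  by move=> x Px; rewrite insubT.
by apply: eq_bigl => b; rewrite valP valK eqxx.
Qed.

Section Sums.
Variables (G : sgraph) (R : nmodType).
Implicit Types (s : {set {set G}}) (e f K P : {set G}) (x y : G) (F : state G -> R).
Local Notation J := (#|G|%:Z - 2)%R.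

Lemma sum_gen i F :
  (\sum_(x < #|gen G i J|) F (val (enum_val x)) = \sum_(b | is_gen i J b) F b)%R.
Proof. by rewrite (sum_enum_val (fun b : gen G i J => F (val b))) sum_sig. Qed.

Lemma state0_inj : injective (@state0 G).
Proof.
move=> P Q [/setP e]; apply/setP => x.
have := e [set x]; rewrite !(mem_imset _ _ (@set1_inj G)) !inE.
exact: negb_inj.
Qed.

Lemma sum_gen0 F :
  (\sum_(b | is_gen 0 J b) F b = \sum_(P : {set G} | #|P| == 2) F (state0 P))%R.
Proof.
transitivity (\sum_(b in @state0 G @: [set P : {set G} | #|P| == 2]) F b)%R.
  apply: eq_bigl => b; apply/is_gen0P/imsetP => [[P P2 ->]|[P]].
    by exists P; rewrite // inE P2.
  by rewrite inE => /eqP P2 ->; exists P.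
rewrite big_imset /=; last by move=> P Q _ _; apply: state0_inj.
by apply: eq_bigl => P; rewrite inE.
Qed.

Lemma sum_gen1 F : (\sum_(b | is_gen 1 J b) F b =
  \sum_(e in edges G) \sum_(K in components [set e]) F (state1 e K))%R.
Proof.
pose A := [set p : {set G} * {set G} | (p.1 \in edges G) && (p.2 \in components [set p.1])].
transitivity (\sum_(b in (fun p => state1 p.1 p.2) @: A) F b)%R.
  apply: eq_bigl => b; apply/is_gen1P/imsetP => [[e [K [eE Kc ->]]]|[[e K]]].
    by exists (e, K); rewrite // inE eE.
  by rewrite inE /= => /andP[eE Kc] ->; exists e, K.
rewrite big_imset /= => [|[e K] [e' K']]; last first.
  rewrite !inE /= => /andP[eE Kc] /andP[e'E K'c] [/set1_inj ee]; subst e'.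
  move=> /setP/(_ K); rewrite !in_setD1 eqxx Kc !andbT => /esym/negbFE/eqP ->.
  by [].
by rewrite pair_big_dep /=; apply: eq_bigl => p; rewrite inE.
Qed.

Lemma state2_inj : injective (@state2 G).
Proof. by move=> s s' [->]. Qed.

Lemma sum_gen2 F : (\sum_(b | is_gen 2 J b) F b =
  \sum_(s : {set {set G}} | (s \subset edges G) && (#|s| == 2)) F (state2 s))%R.
Proof.
transitivity (\sum_(b in @state2 G @:
    [set s : {set {set G}} | (s \subset edges G) && (#|s| == 2)]) F b)%R.
  apply: eq_bigl => b; apply/is_gen2P/imsetP => [[s [sE s2 ->]]|[s]].
    by exists s; rewrite // inE sE s2.
  by rewrite inE => /andP[sE /eqP s2] ->; exists s.
rewrite big_imset /=; last by move=> P Q _ _; apply: state2_inj.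
by apply: eq_bigl => P; rewrite inE.
Qed.

(** The rank of an edge set in the graphic matroid is [#|G|] minus its number of components, here 2.
    These triples turn out to be the edge sets of triangles. *)
Definition rank2_triple s := [&& s \subset edges G, #|s| == 3 & #|components s| + 2 == #|G|].

Lemma sum_gen3 F : (\sum_(b | is_gen 3 J b) F b = \sum_(s | rank2_triple s) F (state2 s))%R.
Proof.
transitivity (\sum_(b in @state2 G @: [set s : {set {set G}} | rank2_triple s]) F b)%R.
  apply: eq_bigl => b; apply/is_gen3P/imsetP => [[s [sE s3 cs ->]]|[s]].
    by exists s; rewrite // inE /rank2_triple sE s3 cs !eqxx.
  by rewrite inE => /and3P[sE /eqP s3 /eqP cs] ->; exists s.
rewrite big_imset /=; last by move=> P Q _ _; apply: state2_inj.
by apply: eq_bigl => P; rewrite inE.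
Qed.

Lemma sum_pairs_at (H : {set {set G}} -> R) e : e \in edges G ->
  (\sum_(s : {set {set G}} | [&& s \subset edges G, #|s| == 2 & e \in s]) H s =
   \sum_(f in edges G | f != e) H (f |: [set e]))%R.
Proof.
move=> eE; transitivity (\sum_(s in (fun f => f |: [set e]) @: [set f in edges G | f != e]) H s)%R.
  apply: eq_bigl => s; apply/and3P/imsetP => [[sE s2 es]|[f]].
    have /eqP := s2; rewrite (cardsD1 e) es => -[/eqP/cards1P[f ef]].
    have : f \in s :\ e by rewrite ef set11.
    rewrite in_setD1 => /andP[nfe fs]; exists f; first by rewrite inE nfe (subsetP sE).
    by rewrite -ef setUC setD1K.
  rewrite inE => /andP[fE nfe] ->; rewrite cards2 nfe !inE eqxx orbT; split=> //.
  by rewrite subUset !sub1set fE.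
rewrite big_imset /= => [|f f']; first by apply: eq_bigl => f; rewrite inE.
rewrite !inE => /andP[_ nfe] /andP[_ nf'e] /setP/(_ f).
by rewrite !inE eqxx (negbTE nfe) !orbF => /esym/eqP.
Qed.

End Sums.

Import Order.TTheory Num.Theory.
Local Open Scope ring_scope.

(** * Integer matrices *)

Definition dvdmx (q : int) m n (A : 'M[int]_(m, n)) :=
  [forall i, forall j, (q %| A i j)%Z].

Lemma dvdmxP q m n (A : 'M_(m, n)) :
  reflect (forall i j, (q %| A i j)%Z) (dvdmx q A).
Proof.
apply: (iffP forallP) => [H i j|H i]; first by have /forallP := H i; apply.
by apply/forallP => j.
Qed.

Lemma dvdmx_mulr q m n p (A : 'M_(m, n)) (B : 'M_(n, p)) :
  dvdmx q A -> dvdmx q (A *m B).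
Proof.
move=> /dvdmxP qA; apply/dvdmxP => i j; rewrite mxE.
by apply: rpred_sum => k _; apply: dvdz_mulr.
Qed.

(* The rows of [P] are a basis of a direct summand; [q = 0] gives their linear
   independence. *)
Definition primitive_mx k l (P : 'M[int]_(k, l)) :=
  forall q (x : 'rV_k), dvdmx q (x *m P) -> dvdmx q x.

(* [P] and [N'] stacked form an invertible matrix, with inverse [P'] and [N]
   side by side. *)
Definition complementary (R : pzRingType) k l s (P : 'M[R]_(k, l)) (P' : 'M_(l, k))
    (N : 'M_(l, s)) (N' : 'M_(s, l)) :=
  [/\ P *m P' = 1%:M, P *m N = 0, N' *m P' = 0, N' *m N = 1%:M
    & P' *m P + N *m N' = 1%:M].

Lemma complementary_map (R S : pzRingType) (f : {rmorphism R -> S}) k l s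
    (P : 'M[R]_(k, l)) P' N (N' : 'M_(s, l)) :
  complementary P P' N N' ->
  complementary (map_mx f P) (map_mx f P') (map_mx f N) (map_mx f N').
Proof.
case=> e1 e2 e3 e4 e5; split; rewrite -!map_mxM -?map_mxD ?(e1, e2, e3, e4, e5) //.
all: by rewrite ?map_mx1 ?map_mx0.
Qed.

Lemma complementary_tr (R : comPzRingType) k l s
    (P : 'M[R]_(k, l)) P' N (N' : 'M_(s, l)) :
  complementary P P' N N' -> complementary P'^T P^T N'^T N^T.
Proof.
by case=> e1 e2 e3 e4 e5; split; rewrite -!trmx_mul -?linearD /=
   ?(e1, e2, e3, e4, e5) ?trmx1 ?trmx0.
Qed.

Lemma complementary_of_unit (R : comUnitRingType) k s (U : 'M[R]_(k + s)) :
  U \in unitmx ->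
  complementary (usubmx U) (lsubmx (invmx U)) (rsubmx (invmx U)) (dsubmx U).
Proof.
move=> uU; have := mulmxV uU; have := mulVmx uU.
rewrite -{2}[U]vsubmxK -{1}[invmx U]hsubmxK mul_row_col => e1.
rewrite -{1}[U]vsubmxK -{1}[invmx U]hsubmxK mul_col_row => e2.
by have [] := eq_block_mx (etrans e2 (scalar_mx_block k s 1)).
Qed.

(** This cuts the Smith normal form at its first zero: by the divisibility chain all later entries
    vanish, and only [r] rows of [R] and [r] columns of [L] survive. *)
Lemma int_Smith_complementary n1 n2 (B : 'M[int]_(n1, n2)) :
  exists r s1 s2 (L : 'M_(n1, r)) (L' : 'M_(r, n1)) (M : 'M_(n1, s1)) (M' : 'M_(s1, n1))
    (P : 'M_(r, n2)) (P' : 'M_(n2, r)) (N : 'M_(n2, s2)) (N' : 'M_(s2, n2))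
    (d : 'rV_r),
  [/\ [/\ n1 = (r + s1)%N, n2 = (r + s2)%N & B = L *m diag_mx d *m P],
      complementary L' L M M', complementary P P' N N'
    & forall i, d 0 i != 0].
Proof.
have [L uL [R uR [d dd ->]]] := int_Smith_normal_form B.
(* The list [d] can be shorter or longer than the diagonal, and [nth] pads it with 0; hence the cap
   by both dimensions. *)
pose r := minn (minn n1 n2) (find (pred1 0) d).
have r1 : (r <= n1)%N by rewrite !geq_min leqnn.
have r2 : (r <= n2)%N by rewrite !geq_min leqnn orbT.
have dn0 i : (i < r)%N -> d`_i != 0.
  rewrite !leq_min => /andP[_ lti].
  by have /= -> := before_find 0 lti.
have d0 i : (r <= i)%N -> (i < n1)%N -> (i < n2)%N -> d`_i = 0.
  move=> ri i1 i2.
  have {ri} ri : (find (pred1 0%:Z) d <= i)%N.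
    move: ri; rewrite /r geq_min => /orP[|//].
    by rewrite geq_min leqNgt i1 leqNgt i2.
  have [id|/(nth_default 0)//] := ltnP i (size d).
  have hd : has (pred1 0%:Z) d by rewrite has_find (leq_ltn_trans ri).
  have /= /eqP z := nth_find 0%:Z hd.
  have [<-//|ne] := eqVneq (find (pred1 0%:Z) d) i.
  have lti : (find (pred1 0%:Z) d < i)%N by rewrite ltn_neqAle ne.
  have := (sorted_ltn_nth (@dvdz_trans) 0 dd) (find (pred1 0%:Z) d) i.
  rewrite !inE id -has_find hd => /(_ isT isT lti); rewrite z dvd0z.
  by move/eqP.
move: r r1 r2 dn0 d0 => r /subnKC r1 /subnKC r2 dn0 d0 {dd}.
(* Once the dimensions are literal sums [r + s1] and [r + s2], the block decompositions need no
   casts. *)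
move: (n1 - r)%N (n2 - r)%N r1 r2 => s1 s2 r1 r2.
case: n1 / r1 in B L uL d0 *; case: n2 / r2 in B R uR d0 *.
have cR := complementary_of_unit uR.
have cL := complementary_of_unit (etrans (unitmx_inv L) uL).
rewrite invmxK in cL.
exists r, s1, s2; do 8! eexists; exists (\row_i d`_i); split; [split=>//|exact: cL|exact: cR|].
  rewrite -{1}[L]hsubmxK -{1}[R]vsubmxK.
  rewrite (_ : \matrix_(i, j) _ = block_mx (diag_mx (\row_i d`_i)) 0 0 0).
    by rewrite mul_row_block !mulmx0 !addr0 mul_row_col mul0mx addr0.
  apply/matrixP => i j; rewrite !mxE.
  case: (split_ordP i) => i' ->; rewrite mxE; case: (split_ordP j) => j' ->; rewrite !mxE /=.
  - by [].
  - by rewrite (ltn_eqF (ltn_addr _ (ltn_ord _))).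
  - by rewrite (gtn_eqF (ltn_addr _ (ltn_ord _))).
  - case: eqP => // e; rewrite d0 ?leq_addr //; first by rewrite ltn_add2l.
    by rewrite e ltn_add2l.
by move=> i; rewrite mxE dn0.
Qed.

(** In the Smith form of [P], primitivity with [q = 0] rules out rows of [M'], which would be
    relations between the rows of [P]. With [q] a diagonal entry it makes that entry divide a row of
    [L'], hence an entry 1 of [L' L]. *)
Lemma primitive_complementary k l (P : 'M[int]_(k, l)) :
  primitive_mx P ->
  exists s (P' : 'M_(l, k)) (N : 'M_(l, s)) (N' : 'M_(s, l)),
    l = (k + s)%N /\ complementary P P' N N'.
Proof.
move=> primP.
have [r [s1 [s2 [L [L' [M [M' [Q [Q' [N [N' [d]]]]]]]]]]]] := int_Smith_complementary P.
case=> -[El ek eP] [e1 e2 e3 e4 e5] cR dn0.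
have s10 : s1 = 0%N.
  case: s1 => // s1 in M M' El e2 e3 e4 e5 *.
  have /matrixP/(_ 0 0) := e4; rewrite !mxE /=.
  suff M0 : forall j, M' 0 j = 0 by rewrite big1 // => j _; rewrite M0 mul0r.
  move=> j; have /dvdmxP/(_ 0 j) : dvdmx 0 (row 0 M').
    apply: primP; rewrite -row_mul eP !mulmxA e3 !mul0mx.
    by apply/dvdmxP => i j'; rewrite !mxE.
  by rewrite mxE dvd0z => /eqP.
subst s1; have LL' : L *m L' = 1%:M.
  by rewrite -e5 [M]thinmx0 mul0mx addr0.
have L'P : L' *m P = diag_mx d *m Q by rewrite eP !mulmxA e1 mul1mx.
have dd : diag_mx d *m diag_mx d = 1%:M.
  rewrite mulmx_diag -[RHS]diag_const_mx; congr diag_mx; apply/rowP => i.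
  rewrite !mxE; have : (d 0%R i %| 1)%Z.
    suff /(@dvdmx_mulr _ _ _ _ _ L)/dvdmxP/(_ 0 i) : dvdmx (d 0 i) (row i L').
      by rewrite -row_mul e1 !mxE eqxx.
    apply: primP.
    rewrite -row_mul L'P; apply/dvdmxP => a j.
    by rewrite mxE mul_diag_mx !mxE dvdz_mulr.
  by rewrite dvdz1 -expr2 -real_normK ?num_real // -abszE => /eqP ->.
have [f1 f2 f3 f4 f5] := cR.
(* The diagonal entries are 1 or -1, so [diag_mx d] is its own inverse. *)
exists s2, (Q' *m diag_mx d *m L'), N, N'; split; first by rewrite ek El addn0.
split=> //.
- by rewrite eP -!mulmxA (mulmxA Q) f1 mul1mx (mulmxA (diag_mx d)) dd mul1mx.
- by rewrite eP -!mulmxA f2 !mulmx0.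
- by rewrite !mulmxA f3 !mul0mx.
rewrite -f5; congr (_ + _).
by rewrite eP -!mulmxA (mulmxA L') e1 mul1mx (mulmxA (diag_mx d) (diag_mx d)) dd mul1mx.
Qed.

(** For [N > 1] this number is gcd(N, d); for prime [N] and [N = 4] it is computed below as a
    power. *)
Definition num_ann N (d : int) := #|[set x : 'Z_N | d%:~R * x == 0]|.

Lemma card_Z_N N : (1 < N)%N -> #|'Z_N| = N.
Proof. by move=> N1; rewrite card_ord Zp_cast. Qed.

Lemma num_ann_absz N d : num_ann N d = num_ann N `|d|%N%:Z.
Proof.
apply: eq_card => x; rewrite !inE.
by case: (intP d) => [|n|n] //; rewrite abszN mulrNz mulNr oppr_eq0.
Qed.

Lemma num_ann_coprime N d : (1 < N)%N -> coprime N `|d| -> num_ann N d = 1%N.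
Proof.
move=> N1 cNd; rewrite num_ann_absz; transitivity #|[set (0 : 'Z_N)]|; last exact: cards1.
apply: eq_card => x; rewrite !inE -pmulrn.
have u : (`|d|%N%:R : 'Z_N) \is a GRing.unit by rewrite unitZpE.
apply/eqP/eqP => [e|->]; last by rewrite mulr0.
by apply: (mulrI u); rewrite e mulr0.
Qed.

Lemma num_ann_dvd N d : (1 < N)%N -> (N %| `|d|)%N -> num_ann N d = N.
Proof.
move=> N1 /eqP Nd; rewrite num_ann_absz -[RHS]card_Z_N // -cardsT.
apply: eq_card => x; rewrite !inE -pmulrn -Zp_nat_mod // Nd mul0r eqxx.
by [].
Qed.

Lemma num_ann_prime p d : prime p -> num_ann p d = (p ^ (p %| `|d|))%N.
Proof.
move=> pp; have p1 := prime_gt1 pp.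
have [pd|npd] := boolP (p %| `|d|)%N; first by rewrite num_ann_dvd.
by rewrite num_ann_coprime // prime_coprime.
Qed.

Lemma num_ann4 d : num_ann 4 d = (2 ^ ((2 %| `|d|) + (4 %| `|d|)))%N.
Proof.
have [d4|nd4] := boolP (4 %| `|d|)%N.
  by rewrite num_ann_dvd // (dvdn_trans _ d4).
rewrite addn0; have [d2|nd2] := boolP (2 %| `|d|)%N; last first.
  by apply: num_ann_coprime => //; apply: (@coprimeXl 2 2); rewrite prime_coprime.
have m2 : (`|d| %% 4 = 2)%N by lia.
rewrite num_ann_absz; transitivity #|[set x : 'Z_4 | 2%:R * x == 0]|.
  apply: eq_card => x; rewrite !inE -pmulrn; congr (_ * _ == _).
  by rewrite -[LHS]Zp_nat_mod // m2.
by rewrite -sum1_card big_mkcond !big_ord_recl big_ord0 /= !inE.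
Qed.

Lemma card_diag_kernel N r (d : 'rV[int]_r) :
  #|[set z : 'cV['Z_N]_r | map_mx intr (diag_mx d) *m z == 0]|
    = (\prod_i num_ann N (d 0%R i))%N.
Proof.
transitivity #|family (fun i => mem [set x : 'Z_N | (d 0%R i)%:~R * x == 0])|; last first.
  rewrite card_family foldrE big_map big_enum /=.
  by apply: eq_bigr => i _; apply: eq_card => x; rewrite !inE.
pose f (z : 'cV['Z_N]_r) := [ffun i => z i 0].
pose g (h : {ffun 'I_r -> 'Z_N}) : 'cV_r := \col_i h i.
have fK : cancel f g by move=> z; apply/colP => i; rewrite mxE ffunE.
have gK : cancel g f by move=> h; apply/ffunP => i; rewrite ffunE mxE.
rewrite -(card_imset _ (can_inj fK)); apply: eq_card => h.
have -> : (h \in f @: [set z : 'cV['Z_N]_r | map_mx intr (diag_mx d) *m z == 0])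
   = (map_mx intr (diag_mx d) *m g h == 0).
  apply/imsetP/idP => [[z]|e]; first by rewrite inE => e ->; rewrite fK.
  by exists (g h); rewrite ?inE ?gK.
rewrite map_diag_mx mul_diag_mx; apply/eqP/familyP => [e i|e].
  by have /colP/(_ i) := e; rewrite !mxE !inE => ->.
by apply/colP => i; have := e i; rewrite !mxE !inE => /eqP.
Qed.

(** Complementary pairs remain so modulo [N]. In the coordinates [(P y, N' y)] the equation only
    involves the first component and is diagonal there, so the other [s2] coordinates are free. *)
Lemma card_kernel_Smith N n1 n2 (B : 'M[int]_(n1, n2)) r s1 s2 L L' M M' P P' N0 N' d :
  B = L *m diag_mx d *m P ->
  complementary L' L (M : 'M_(n1, s1)) M' ->
  complementary (P : 'M_(r, n2)) P' (N0 : 'M_(n2, s2)) N' ->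
  #|[set y : 'cV['Z_N]_n2 | map_mx intr B *m y == 0]|
    = (\prod_i num_ann N (d 0%R i) * #|'Z_N| ^ s2)%N.
Proof.
move=> -> /(complementary_map (intr : {rmorphism int -> 'Z_N})) [e1 e2 e3 e4 e5].
move=> /(complementary_map (intr : {rmorphism int -> 'Z_N})) [f1 f2 f3 f4 f5].
rewrite -card_diag_kernel !map_mxM.
move: (map_mx _ L) (map_mx _ L') (map_mx _ M) (map_mx _ M') (map_mx _ P)
  e1 e2 e3 e4 e5 f1 f2 f3 f4 f5.
move: (map_mx _ P') (map_mx _ N0) (map_mx _ N') => {L L' M M' P P' N0 N'}.
move=> P' N0 N' L L' M M' P e1 e2 e3 e4 e5 f1 f2 f3 f4 f5.
rewrite -[in RHS](muln1 s2) -card_mx -cardsT -cardsX.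
pose f (y : 'cV['Z_N]_n2) := (P *m y, N' *m y).
pose g (h : 'cV['Z_N]_r * 'cV['Z_N]_s2) := P' *m h.1 + N0 *m h.2.
have fK : cancel f g by move=> y; rewrite /f /g /= !mulmxA -mulmxDl f5 mul1mx.
have gK : cancel g f.
  move=> [z w]; rewrite /f /g /= !mulmxDr !mulmxA f1 f2 f3 f4.
  by rewrite !mul0mx !mul1mx addr0 add0r.
rewrite -(on_card_preimset (f := f)); last by apply: onW_bij; exists g.
apply: eq_card => y; rewrite !inE andbT; apply/eqP/eqP => [e|e].
  by rewrite -[LHS]mul1mx -e1 -!mulmxA (mulmxA L) (mulmxA (L *m _)) e mulmx0.
by rewrite -!mulmxA e mulmx0.
Qed.

(* A large prime [N] counts the zero diagonal entries; comparing with the other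
   odd primes and with [4] shows that the nonzero ones divide [2]. *)
Lemma Smith_of_counts n1 n2 (B : 'M[int]_(n1, n2)) a b :
  (forall N, prime N || (N == 4) ->
    #|[set y : 'cV['Z_N]_n2 | map_mx intr B *m y == 0]|
       = (N ^ b * num_ann N 2 ^ a)%N) ->
  exists r s1 (L : 'M_(n1, r)) (L' : 'M_(r, n1)) (M : 'M_(n1, s1)) (M' : 'M_(s1, n1))
    (P : 'M_(r, n2)) (P' : 'M_(n2, r)) (N : 'M_(n2, b)) (N' : 'M_(b, n2))
    (d : 'rV_r),
  [/\ [/\ n1 = (r + s1)%N, n2 = (r + b)%N & B = L *m diag_mx d *m P],
      complementary L' L M M', complementary P P' N N',
      forall i, (`|d 0%R i| == 1)%N || (`|d 0%R i| == 2)%N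
    & #|[set i | `|d 0%R i| == 2]%N| = a].
Proof.
move=> HN.
have [r [s1 [s2 [L [L' [M [M' [Q [Q' [N [N' [d]]]]]]]]]]]] := int_Smith_complementary B.
case=> -[El ek eP] cL cR dn0.
have cnt M0 : prime M0 || (M0 == 4) ->
   (\prod_i num_ann M0 (d 0%R i) * M0 ^ s2)%N = (M0 ^ b * num_ann M0 2 ^ a)%N.
  move=> hM0; rewrite -HN // (card_kernel_Smith _ eP cL cR) card_Z_N //.
  by case/orP: hM0 => [/prime_gt1|/eqP->].
have sum1 (Pr : 'I_r -> bool) : (\sum_i (Pr i : nat) = #|[set i | Pr i]|)%N.
  by rewrite -sum1_card [RHS]big_mkcond; apply: eq_bigr => i _; rewrite inE; case: (Pr i).
(* Both sides of [cnt] are powers of [p]; this compares their exponents. *)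
have cntp p : prime p -> (#|[set i | p %| `|d 0%R i| ]%N| + s2 = b + (p == 2) * a)%N.
  move=> pp; have := cnt p; rewrite pp => /(_ isT).
  under eq_bigr do rewrite num_ann_prime //.
  rewrite -expn_sum sum1 num_ann_prime // -expnM -!expnD (dvdn_prime2 pp) // => /eqP.
  by rewrite eqn_exp2l ?prime_gt1 // => /eqP.
have cnt4 : (#|[set i | 2 %| `|d 0%R i| ]%N| +
     #|[set i | 4 %| `|d 0%R i| ]%N| + 2 * s2 = 2 * b + a)%N.
  have e4 n : (4 ^ n = 2 ^ (2 * n))%N by rewrite expnM.
  have := cnt 4%N isT; under eq_bigr do rewrite num_ann4.
  rewrite -expn_sum big_split /= !sum1 num_ann4 /= !e4 expn1 -!expnD => /eqP.
  by rewrite eqn_exp2l // => /eqP; lia.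
have s2b : s2 = b.
  (* This prime divides none of the nonzero entries, and the [.+2] makes it different from 2. *)
  have [p ltp pp] := prime_above (\max_i `|d 0%R i|)%N.+2.
  have := cntp p pp; rewrite (_ : p == 2 = false); last by apply/eqP; lia.
  rewrite (_ : [set i | _] = set0) ?cards0; first lia.
  apply/setP => i; rewrite !inE; apply/negP => /dvdn_leq.
  rewrite absz_gt0 dn0 leqNgt => /(_ isT)/negP[]; apply: leq_trans ltp.
  have := @leq_bigmax _ (fun i => `|d 0%R i|%N) i; rewrite ltnS => /leq_trans; apply.
  by rewrite -addn2 leq_addr.
subst s2; exists r, s1, L, L', M, M', Q, Q', N, N', d.
have e2 := cntp 2%N isT; rewrite /= mul1n in e2.
(* With [s2 = b], the count at 2 says that [a] entries are even; the count at 4 then leaves none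
   divisible by 4. *)
have {cnt4} c4 : [set i | 4 %| `|d 0%R i| ]%N = set0.
  apply/eqP; rewrite -cards_eq0; move: cnt4 e2; set x := #|_|; set y := #|_|; lia.
have podd p i : prime p -> p != 2 -> ~~ (p %| `|d 0%R i|)%N.
  move=> pp /negbTE p2; have := cntp p pp; rewrite p2 => e.
  have : [set i | p %| `|d 0%R i| ]%N == set0 by rewrite -cards_eq0; lia.
  by move=> /eqP/setP/(_ i); rewrite !inE => ->.
have d12 i : (`|d 0%R i| == 1)%N || (`|d 0%R i| == 2)%N.
  have /setP/(_ i) := c4; rewrite !inE => n4.
  have := dn0 i; rewrite -absz_gt0; move: (podd ^~ i) n4.
  move: `|d 0%R i|%N => n pn n4 n0.
  have [dv2|nn2] := boolP (2 %| n)%N.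
    have [k ek2] := dvdnP dv2; have [k1|] := leqP k 1; first lia.
    move=> /pdivP [p pp pk]; have [p2|p2] := eqVneq p 2.
      rewrite p2 in pk; have := dvdn_mul pk (dvdnn 2).
      by rewrite -ek2 n4.
    by have /negP[] := pn p pp p2; rewrite ek2 dvdn_mulr.
  have [n1'|] := leqP n 1; first lia.
  move=> /pdivP [p pp pk]; have [p2|p2] := eqVneq p 2; first by rewrite p2 in pk; rewrite pk in nn2.
  by have /negP[] := pn p pp p2.
split=> //.
rewrite (_ : [set i | _] = [set i | 2 %| `|d 0%R i| ]%N); first
  by move/eqP: e2; rewrite [(b + a)%N]addnC eqn_add2r => /eqP.
by apply/setP => i; rewrite !inE; case/orP: (d12 i) => /eqP ->.
Qed.

(** * Alternating forms annihilated by incidence matrices *)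

Section Alternating.
Variable R : comNzRingType.

(** The diagonal is a separate condition because antisymmetry only kills its double, and 2 can be a
    zero divisor in Z/N. *)
Definition alternating m (w : 'M[R]_m) :=
  (w^T == - w) && [forall i, w i i == 0].

(** The witness is the part of [w] above the diagonal. In this shape, closure under sums and
    congruences includes the diagonal condition at no cost. *)
Lemma alternatingP m (w : 'M[R]_m) :
  reflect (exists u, w = u - u^T) (alternating w).
Proof.
apply: (iffP andP) => [[/eqP wT /forallP w0]|[u ->]].
  exists (\matrix_(i, j) (w i j *+ (i < j)%N)).
  apply/matrixP => i j; rewrite !mxE.
  have -> : w j i = - w i j by have /matrixP/(_ i j) := wT; rewrite !mxE.
  case: (ltngtP i j) => [||/val_inj->]; rewrite ?subr0 ?sub0r ?opprK //.
  exact/eqP.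
split; first by rewrite linearB /= trmxK opprB.
by apply/forallP => i; rewrite !mxE subrr.
Qed.

Lemma alternating_tr m (w : 'M[R]_m) : alternating w -> w^T = - w.
Proof. by case/andP => /eqP. Qed.

Lemma alternating_sub_tr m (u : 'M[R]_m) : alternating (u - u^T).
Proof. by apply/alternatingP; exists u. Qed.

Lemma alternatingD m (v w : 'M[R]_m) :
  alternating v -> alternating w -> alternating (v + w).
Proof.
move=> /alternatingP[u ->] /alternatingP[u' ->]; apply/alternatingP.
by exists (u + u'); rewrite linearD /= opprD addrACA.
Qed.

Lemma alternatingN m (w : 'M[R]_m) : alternating w -> alternating (- w).
Proof.
move=> /alternatingP[u ->]; apply/alternatingP.
by exists (- u); rewrite linearN /= opprK opprB addrC.
Qed.

Lemma alternatingB m (v w : 'M[R]_m) :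
  alternating v -> alternating w -> alternating (v - w).
Proof. by move=> av /alternatingN; apply: alternatingD. Qed.

Lemma alternating_congr m k (X : 'M[R]_(k, m)) (w : 'M[R]_m) :
  alternating w -> alternating (X *m w *m X^T).
Proof.
move=> /alternatingP[u ->]; apply/alternatingP; exists (X *m u *m X^T).
by rewrite mulmxBr mulmxBl !trmx_mul trmxK mulmxA.
Qed.

Lemma alternating1 (w : 'M[R]_1) : alternating w -> w = 0.
Proof. by case/andP => _ /forallP/(_ 0)/eqP w0; apply/matrixP => i j; rewrite !ord1 w0 mxE. Qed.

Lemma alternating0 m : alternating (0 : 'M[R]_m).
Proof. by apply/alternatingP; exists 0; rewrite trmx0 subrr. Qed.

Section Complementary.
Variables (m k s : nat) (P : 'M[R]_(k, m)) (P' : 'M[R]_(m, k)).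
Variables (N : 'M[R]_(m, s)) (N' : 'M[R]_(s, m)).
Hypothesis cP : complementary P P' N N'.

Lemma alternating_eq0 (w : 'M[R]_m) :
  alternating w -> P *m w = 0 -> N' *m w *m N'^T = 0 -> w = 0.
Proof.
move=> aw Pw Nw; have [_ _ _ _ e] := cP.
have wP : w *m P^T = 0.
  by rewrite -[w]opprK -(alternating_tr aw) mulNmx -trmx_mul Pw trmx0 oppr0.
have e' : P^T *m P'^T + N'^T *m N^T = 1%:M by rewrite -!trmx_mul -linearD /= e trmx1.
rewrite -[w]mulmx1 -e' mulmxDr mulmxA wP mul0mx add0r -[w]mul1mx -e mulmxDl -(mulmxA P') Pw.
by rewrite mulmx0 add0r -!mulmxA (mulmxA w) (mulmxA N') (mulmxA N') Nw mul0mx mulmx0.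
Qed.

(** In the basis formed by the rows of [P] and of [N'], the values against [P] and the block on [N']
    can be prescribed independently; the only compatibility condition is that the block on [P],
    which is [L P^T], be alternating. *)
Lemma alternating_solve (L : 'M[R]_(k, m)) (w0 : 'M[R]_s) :
  alternating (L *m P^T) -> alternating w0 ->
  exists w, [/\ alternating w, P *m w = L & N' *m w *m N'^T = w0].
Proof.
move=> aS aw; have [e1 e2 e3 e4 e5] := cP.
(* The first two terms fill the strips at [P], in rows and in columns, and so count the block on [P]
   twice; the third removes one copy. *)
exists (P' *m L - (P' *m L)^T - P' *m (L *m P^T) *m P'^T + N *m w0 *m N^T); split.
- apply: alternatingD; last exact: alternating_congr.
  by apply: alternatingB; [exact: alternating_sub_tr|exact: alternating_congr].
- rewrite mulmxDr !mulmxBr !mulmxA e1 e2 !mul1mx !mul0mx addr0 trmx_mul mulmxA.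
  rewrite -[P *m L^T]trmxK trmx_mul trmxK (alternating_tr aS) mulNmx opprK.
  by rewrite addrK.
have h2 : P'^T *m N'^T = 0 by rewrite -trmx_mul e3 trmx0.
have h3 : N^T *m N'^T = 1%:M by rewrite -trmx_mul e4 trmx1.
rewrite mulmxDr !mulmxBr !mulmxDl !mulNmx trmx_mul !mulmxA e3 e4 !mul0mx mul1mx.
by rewrite -!mulmxA h2 h3 mulmx1 !mulmx0 !subr0 add0r.
Qed.
End Complementary.

Lemma alternating_block m (r : 'rV[R]_m) (w : 'M[R]_m) :
  alternating (block_mx 0 r (- r^T) w) = alternating w.
Proof.
rewrite /alternating tr_block_mx opp_block_mx trmx0 linearN /= trmxK oppr0 opprK.
congr (_ && _); first by apply/eqP/eqP => [/eq_block_mx[]|->].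
apply/forallP/forallP => H i.
  by have := H (rshift 1 i); rewrite block_mxEdr.
by case: (split_ordP i) => j ->; rewrite ?block_mxEul ?block_mxEdr // mxE.
Qed.

End Alternating.

Lemma card_alternating (R : finComNzRingType) m :
  #|[set w : 'M[R]_m | alternating w]| = (#|R| ^ 'C(m, 2))%N.
Proof.
elim: m => [|m IH].
  rewrite (_ : [set _ | _] = setT) ?cardsT ?card_mx ?expn0 //.
  by apply/setP => w; rewrite !inE (flatmx0 w) alternating0.
rewrite binS bin1 expnD -IH.
transitivity #|setX [set: 'rV[R]_m] [set w : 'M[R]_m | alternating w]|; last first.
  by rewrite cardsX cardsT card_mx mul1n mulnC.
pose f (x : 'rV[R]_m * 'M[R]_m) : 'M[R]_(1 + m) := block_mx 0 x.1 (- x.1^T) x.2.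
have fI : injective f by move=> [r w] [r' w'] /eq_block_mx[/= _ -> _ ->].
rewrite -(card_imset _ fI).
suff H (w : 'M[R]_(1 + m)) : alternating w =
    (w \in f @: setX [set: 'rV[R]_m] [set w : 'M[R]_m | alternating w]).
  by apply: eq_card => w; rewrite inE; apply: H.
apply/idP/imsetP => [aw|[[r w']]]; last first.
  by rewrite !inE /= => aw' ->; rewrite alternating_block.
have fw : w = f (ursubmx w, drsubmx w).
  rewrite /f /= -{1}[w]submxK trmx_ursub (alternating_tr aw); congr block_mx.
    rewrite [X in X = _](@alternating1 _ (ulsubmx w)) //.
    have := alternating_congr (row_mx 1%:M 0 : 'M_(1, 1 + m)) aw.
    rewrite -{1}[w]submxK mul_row_block tr_row_mx mul_row_col !mul1mx !mul0mx.
    by rewrite !addr0 trmx1 trmx0 mulmx1 mulmx0 addr0.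
  by apply/matrixP => i j; rewrite !mxE opprK.
exists (ursubmx w, drsubmx w) => //.
by rewrite !inE /= -(alternating_block (ursubmx w)) -[block_mx _ _ _ _]fw.
Qed.

(** * Incidence matrices, circulations and the forms they constrain *)

Section Incidence.
Variables (n m : nat) (a b : 'I_m -> 'I_(1 + n)).

Definition unsigned_inc (R : pzRingType) : 'M[R]_(1 + n, m) :=
  \matrix_(u, e) ((u == a e)%:R + (u == b e)%:R).

Definition signed_inc (R : pzRingType) : 'M[R]_(1 + n, m) :=
  \matrix_(u, e) ((u == a e)%:R - (u == b e)%:R).

Lemma sum_delta (R : pzRingType) (x : 'I_(1 + n) -> R) v :
  \sum_u x u * (u == v)%:R = x v.
Proof.
rewrite (bigD1 v) //= eqxx mulr1 big1 ?addr0 // => u /negbTE ->.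
by rewrite mulr0.
Qed.

Lemma mul_unsigned (R : pzRingType) k (x : 'M[R]_(k, 1 + n)) i e :
  (x *m unsigned_inc R) i e = x i (a e) + x i (b e).
Proof.
rewrite mxE; under eq_bigr do rewrite mxE mulrDr.
by rewrite big_split /= !sum_delta.
Qed.

Lemma mul_signed (R : pzRingType) k (x : 'M[R]_(k, 1 + n)) i e :
  (x *m signed_inc R) i e = x i (a e) - x i (b e).
Proof.
rewrite mxE; under eq_bigr do rewrite mxE mulrBr.
by rewrite sumrB /= !sum_delta.
Qed.

Lemma map_unsigned (R S : pzRingType) (f : {rmorphism R -> S}) :
  map_mx f (unsigned_inc R) = unsigned_inc S.
Proof. by apply/matrixP => u e; rewrite !mxE rmorphD !rmorph_nat. Qed.

Lemma map_signed (R S : pzRingType) (f : {rmorphism R -> S}) :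
  map_mx f (signed_inc R) = signed_inc S.
Proof. by apply/matrixP => u e; rewrite !mxE rmorphB !rmorph_nat. Qed.

Hypothesis neq_ab : forall e, a e != b e.

(** An edge between distinct [u] and [w] contributes opposite values at [(u, w)] and [(w, u)], so
    off the diagonal antisymmetry is automatic. The diagonal entry at [u] is the net flow of [l]
    through [u]. *)
Lemma alternating_incidence (R : comNzRingType) (l : 'rV[R]_m) :
  reflect (l *m (signed_inc R)^T = 0)
    (alternating (signed_inc R *m diag_mx l *m (unsigned_inc R)^T)).
Proof.
have eM u w : (signed_inc R *m diag_mx l *m (unsigned_inc R)^T) u w =
    \sum_e signed_inc R u e * l 0 e * unsigned_inc R w e.
  by rewrite mxE; apply: eq_bigr => e _; rewrite mul_mx_diag !mxE.
have eD u : (signed_inc R *m diag_mx l *m (unsigned_inc R)^T) u u =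
    (l *m (signed_inc R)^T) 0 u.
  rewrite eM mxE; apply: eq_bigr => e _; rewrite !mxE.
  have /eqP nab := neq_ab e.
  by do 2![case: eqP => ? /=]; try (by exfalso; congruence); ring.
apply: (iffP andP) => [[_ /forallP d0]|d0].
  by apply/rowP => u; rewrite -eD [RHS]mxE; exact/eqP.
split; last by apply/forallP => u; rewrite eD d0 mxE.
apply/eqP/matrixP => u w; rewrite [LHS]mxE [RHS]mxE.
have [->|neq_uw] := eqVneq u w; first by rewrite eD d0 mxE oppr0.
rewrite !eM -sumrN; apply: eq_bigr => e _; rewrite !mxE.
have /eqP nab := neq_ab e; move/eqP: neq_uw => nuw.
by do 4![case: eqP => ? /=]; try (by exfalso; congruence); ring.
Qed.

Definition inc_forms (R : finComNzRingType) :=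
  [set w : 'M[R]_m | alternating w &&
    [exists l : 'rV_m, unsigned_inc R *m w == signed_inc R *m diag_mx l]].

(* The [l] of [inc_forms], read off at the end [a e] of each edge. *)
Definition inc_flow (R : pzRingType) (w : 'M[R]_m) : 'rV_m :=
  \row_e (unsigned_inc R *m w) (a e) e.

Lemma inc_flow_eq (R : comNzRingType) (w : 'M[R]_m) l :
  unsigned_inc R *m w = signed_inc R *m diag_mx l -> inc_flow w = l.
Proof.
move=> e; apply/rowP => i; rewrite mxE e mul_mx_diag !mxE eqxx (negbTE (neq_ab i)).
by rewrite subr0 mul1r.
Qed.

Lemma inc_formsP (R : finComNzRingType) (w : 'M[R]_m) :
  reflect (alternating w /\
    unsigned_inc R *m w = signed_inc R *m diag_mx (inc_flow w)) (w \in inc_forms R).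
Proof.
rewrite inE; apply: (iffP andP) => [[-> /existsP[l /eqP e]]|[-> e]].
  by split=> //; rewrite (inc_flow_eq e).
by split=> //; apply/existsP; exists (inc_flow w); rewrite -e.
Qed.

Lemma inc_flowB (R : comNzRingType) (v w : 'M[R]_m) :
  inc_flow (v - w) = inc_flow v - inc_flow w.
Proof. by apply/rowP => e; rewrite [LHS]mxE mulmxBr !mxE. Qed.

Lemma inc_formsB (R : finComNzRingType) (v w : 'M[R]_m) :
  v \in inc_forms R -> w \in inc_forms R -> v - w \in inc_forms R.
Proof.
move=> /inc_formsP[av ev] /inc_formsP[aw ew]; apply/inc_formsP; split.
  exact: alternatingB.
by rewrite mulmxBr ev ew inc_flowB linearB /= mulmxBr.
Qed.

(** Multiplying the equation by [D^T] gives [D w D^T = I diag(l) D^T], and the left side is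
    alternating. *)
Lemma inc_flow_circ (R : finComNzRingType) (w : 'M[R]_m) :
  w \in inc_forms R -> inc_flow w *m (signed_inc R)^T = 0.
Proof.
move=> /inc_formsP[aw ew]; apply/alternating_incidence; rewrite -ew.
exact: alternating_congr.
Qed.

(** Every column of [I] sums to 0, so conservation at all vertices but one implies it at the
    last. *)
Lemma circ_row0 (R : comNzRingType) (l : 'rV[R]_m) :
  l *m (dsubmx (signed_inc R))^T = 0 -> l *m (signed_inc R)^T = 0.
Proof.
move=> l0; have l0' u : (l *m (signed_inc R)^T) 0 (rshift 1 u) = 0.
  have /rowP/(_ u) := l0; rewrite [RHS]mxE => e; rewrite -[RHS]e !mxE.
  by apply: eq_bigr => i _; rewrite !mxE.
apply/rowP => u; rewrite [RHS]mxE; case: (split_ordP u) => j -> //.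
have : \sum_u (l *m (signed_inc R)^T) 0 u = 0.
  transitivity (\sum_e l 0 e * (const_mx 1 *m signed_inc R : 'rV_m) 0 e).
    under eq_bigr do rewrite mxE; rewrite exchange_big; apply: eq_bigr => e _.
    by rewrite mxE big_distrr /=; apply: eq_bigr => i _; rewrite !mxE mul1r.
  by rewrite big1 // => e _; rewrite mul_signed !mxE subrr mulr0.
by rewrite big_split_ord /= big_ord1 [X in _ + X]big1 // addr0 !ord1.
Qed.

(** The equation at vertex 0 may be traded for any combination in which that vertex has coefficient
    1; [x] is chosen later so that the combination of the [delta_u] becomes simple. *)
Lemma inc_forms_row0 (R : comNzRingType) (w : 'M[R]_m) l (x : 'rV[R]_n) :
  dsubmx (unsigned_inc R) *m w = dsubmx (signed_inc R) *m diag_mx l ->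
  row_mx 1%:M x *m unsigned_inc R *m w = row_mx 1%:M x *m signed_inc R *m diag_mx l ->
  unsigned_inc R *m w = signed_inc R *m diag_mx l.
Proof.
move=> ed; rewrite -[unsigned_inc R]vsubmxK -[signed_inc R]vsubmxK.
rewrite !mul_row_col !mul1mx !mulmxDl -!mulmxA ed => /addIr eu.
by rewrite !mul_col_mx eu ed.
Qed.

End Incidence.

Lemma card_eq_bij (aT rT : finType) (A : {set aT}) (T : {set rT}) (f : aT -> rT) :
  {in A, forall x, f x \in T} -> {in A &, injective f} ->
  {in T, forall y, exists2 x, x \in A & f x = y} -> #|A| = #|T|.
Proof.
move=> fT fI fS; rewrite -(card_in_imset fI); apply: eq_card => y.
apply/imsetP/idP => [[x xA ->]|/fS[x xA <-]]; first exact: fT.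
by exists x.
Qed.

Lemma card_2torsion N p :
  #|[set z : 'rV['Z_N]_p | z *+ 2 == 0]| = (num_ann N 2 ^ p)%N.
Proof.
transitivity #|[set z : 'cV['Z_N]_p | map_mx intr (diag_mx (const_mx 2%:Z : 'rV_p)) *m z == 0]|.
  apply: (card_eq_bij (f := fun z : 'rV['Z_N]_p => z^T)) => [z|z z' _ _ /trmx_inj//|z].
    rewrite !inE => /eqP z2; rewrite map_diag_mx mul_diag_mx; apply/eqP/colP => i.
    by have /rowP/(_ i) := z2; rewrite mulmxnE !mxE /= -pmulrn mulr_natl.
  rewrite inE => /eqP z2; exists z^T; last exact: trmxK.
  rewrite inE; apply/eqP/rowP => i; have /colP/(_ i) := z2.
  by rewrite map_diag_mx mul_diag_mx mulmxnE !mxE /= -pmulrn mulr_natl.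
rewrite card_diag_kernel; under eq_bigr do rewrite mxE.
by rewrite prod_nat_const card_ord.
Qed.

Lemma mulmxMnl (R : pzRingType) k l p (A : 'M[R]_(k, l)) (B : 'M[R]_(l, p)) i :
  A *+ i *m B = (A *m B) *+ i.
Proof. exact: (raddfMn (mulmxr B)). Qed.

Lemma mulmxMnr (R : pzRingType) k l p (A : 'M[R]_(k, l)) (B : 'M[R]_(l, p)) i :
  A *m (B *+ i) = (A *m B) *+ i.
Proof. exact: (raddfMn (mulmx A)). Qed.

(** * Number of constrained forms of a connected graph *)

Section Counting.
Variables (n m : nat) (a b : 'I_m -> 'I_(1 + n)).
Hypothesis neq_ab : forall e, a e != b e.
Hypothesis conn : forall Q : pred 'I_(1 + n), (forall e, Q (a e) = Q (b e)) ->
  forall u v, Q u -> Q v.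

Let D R := unsigned_inc a b R.
Let I R := signed_inc a b R.

Lemma primitive_incidence (S : 'M[int]_(1 + n, m)) :
  (forall (x : 'rV_(1 + n)) e, (x *m S) 0 e = x 0 (a e) + x 0 (b e)) \/
  (forall (x : 'rV_(1 + n)) e, (x *m S) 0 e = x 0 (a e) - x 0 (b e)) ->
  primitive_mx (dsubmx S).
Proof.
(* Vertex 0 is given the coefficient 0, a multiple of every [q], and divisibility passes from one
   end of an edge to the other. *)
move=> HS q x; pose X : 'rV_(1 + n) := row_mx 0 x.
have -> : x *m dsubmx S = X *m S by rewrite -{2}[S]vsubmxK mul_row_col mul0mx add0r.
move=> /dvdmxP qX; have cn := conn (Q := fun u => (q %| X 0%R u)%Z).
apply/dvdmxP => i u; rewrite ord1; have -> : x 0 u = X 0 (rshift 1 u) by rewrite row_mxEr.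
apply: (cn _ (lshift n 0)) => [e|]; last by rewrite row_mxEl mxE.
have := qX 0 e; case: HS => -> h; apply/idP/idP => h1.
- by rewrite -(addKr (X 0 (a e)) (X 0 (b e))) rpredD ?rpredN.
- by rewrite -(addrK (X 0 (b e)) (X 0 (a e))) rpredB.
- by rewrite -(subKr (X 0 (a e)) (X 0 (b e))) rpredB.
- by rewrite -(subrK (X 0 (b e)) (X 0 (a e))) rpredD.
Qed.

(** The matrix [S] is a family over all rings so that a single integral complement serves, after
    reduction, for every Z/N and for the integers. *)
Lemma incidence_complement (S : forall R : pzRingType, 'M[R]_(1 + n, m)) :
  (forall (R R' : pzRingType) (f : {rmorphism R -> R'}), map_mx f (S R) = S R') ->
  (forall (x : 'rV_(1 + n)) e, (x *m S int) 0 e = x 0 (a e) + x 0 (b e)) \/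
  (forall (x : 'rV_(1 + n)) e, (x *m S int) 0 e = x 0 (a e) - x 0 (b e)) ->
  (n <= m)%N /\
  exists P' (N : 'M[int]_(m, m - n)) N',
    forall R : comNzRingType, complementary (dsubmx (S R))
      (map_mx intr P') (map_mx intr N) (map_mx intr N').
Proof.
move=> mapS HS.
have [s [P' [N [N' [em cP]]]]] := primitive_complementary (primitive_incidence HS).
have es : s = (m - n)%N by rewrite em addKn.
split; first by rewrite em leq_addr.
move: N N' cP; rewrite es => N N' cP; exists P', N, N' => R.
have := complementary_map (intr : {rmorphism int -> R}) cP.
by rewrite map_dsubmx mapS.
Qed.

Lemma unsigned_complement : (n <= m)%N /\
  exists P' (N : 'M[int]_(m, m - n)) N',
    forall R : comNzRingType, complementary (dsubmx (D R))
      (map_mx intr P') (map_mx intr N) (map_mx intr N').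
Proof.
apply: incidence_complement; first exact: map_unsigned.
by left=> x e; rewrite mul_unsigned.
Qed.

Lemma signed_complement : (n <= m)%N /\
  exists Q' (Z : 'M[int]_(m, m - n)) Z',
    forall R : comNzRingType, complementary (dsubmx (I R))
      (map_mx intr Q') (map_mx intr Z) (map_mx intr Z').
Proof.
apply: incidence_complement; first exact: map_signed.
by right=> x e; rewrite mul_signed.
Qed.

Lemma leq_rank_edges : (n <= m)%N.
Proof. by case: unsigned_complement. Qed.

(** This is the compatibility condition of [alternating_solve] for the equations at the vertices
    other than 0. *)
Lemma alternating_dsub_incidence (R : comNzRingType) (l : 'rV[R]_m) :
  l *m (I R)^T = 0 -> alternating (dsubmx (I R) *m diag_mx l *m (dsubmx (D R))^T).
Proof.
have h k (X : 'M[R]_(1 + n, k)) : row_mx 0 1%:M *m X = dsubmx X.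
  by rewrite -{1}[X]vsubmxK mul_row_col mul0mx mul1mx add0r.
move=> /(alternating_incidence neq_ab)/(alternating_congr (row_mx 0 1%:M)).
by rewrite !mulmxA h -mulmxA -trmx_mul h.
Qed.

Section Circulations.
Variables (R : comNzRingType) (s : nat) (Q' : 'M[R]_(m, n)) (Z : 'M[R]_(m, s)) (Z' : 'M[R]_(s, m)).
Hypothesis cI : complementary (dsubmx (I R)) Q' Z Z'.

(** The columns of [Z] are a basis of the circulations, so [z] is a coordinate vector on the cycle
    space. *)
Lemma circ_param (z : 'rV[R]_s) : z *m Z^T *m (I R)^T = 0.
Proof.
apply: circ_row0; have [_ e _ _ _] := cI.
by rewrite -mulmxA -trmx_mul e trmx0 mulmx0.
Qed.

Lemma circ_paramK (z : 'rV[R]_s) : z *m Z^T *m Z'^T = z.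
Proof. by have [_ _ _ e _] := cI; rewrite -mulmxA -trmx_mul e trmx1 mulmx1. Qed.

Lemma circ_eq0 (l : 'rV[R]_m) : l *m (I R)^T = 0 -> l *m Z'^T = 0 -> l = 0.
Proof.
move=> lI lZ; have [_ _ _ _ e] := cI.
have {}lI : l *m (dsubmx (I R))^T = 0.
  rewrite -[I R]vsubmxK tr_col_mx mul_mx_row in lI.
  by have [] := eq_row_mx (etrans lI (esym (row_mx0 _ _ _ _))).
rewrite -[l]mulmx1 -trmx1 -e linearD /= !trmx_mul mulmxDr !mulmxA lI lZ.
by rewrite !mul0mx addr0.
Qed.

End Circulations.

Lemma inc_forms_eq0 (R : finComNzRingType) s P' (N : 'M[R]_(m, s)) N' Q' (Z : 'M[R]_(m, s)) Z'
    (cD : complementary (dsubmx (D R)) P' N N') 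
    (cI : complementary (dsubmx (I R)) Q' Z Z') (w : 'M[R]_m) :
  w \in inc_forms a b R ->
  inc_flow a b w *m Z'^T = 0 -> N' *m w *m N'^T = 0 -> w = 0.
Proof.
move=> wK l0 Nw; have [aw Dw] := inc_formsP neq_ab w wK.
rewrite (circ_eq0 cI (inc_flow_circ neq_ab wK) l0) [diag_mx 0]raddf0 mulmx0 in Dw.
apply: (alternating_eq0 cD) => //.
by rewrite mul_dsub_mx Dw; apply/matrixP => i j; rewrite !mxE.
Qed.

Lemma card_inc_forms_bipartite N (c : 'I_(1 + n) -> bool) :
  (forall e, c (a e) != c (b e)) ->
  #|inc_forms a b 'Z_N| = (#|'Z_N| ^ 'C(m - n, 2) * num_ann N 2 ^ (m - n))%N.
Proof.
move=> cc; have [_ [P' [M [M' /(_ 'Z_N) cD]]]] := unsigned_complement.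
have [_ [Q' [Z [Z' /(_ 'Z_N) cI]]]] := signed_complement.
move: (map_mx _ P') (map_mx _ M) (map_mx _ M') (map_mx _ Q') (map_mx _ Z) (map_mx _ Z') cD cI.
move=> {P' M M' Q' Z Z'} P' M M' Q' Z Z' cD cI.
(* The signs of the 2-colouring, normalized to 1 at vertex 0: with them the [delta_u] add up to
   0. *)
pose x : 'rV['Z_N]_n := \row_u (-1) ^+ (c (rshift 1 u) (+) c (lshift n 0)).
have x_eq u : (row_mx 1%:M x : 'rV_(1 + n)) 0 u = (-1) ^+ (c u (+) c (lshift n 0)).
  case: (split_ordP u) => j ->; last by rewrite row_mxEr mxE.
  by rewrite ord1 row_mxEl mxE addbb.
have xD : row_mx 1%:M x *m D 'Z_N = 0.
  apply/rowP => e; rewrite mul_unsigned !x_eq mxE.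
  have := cc e; case: (c (a e)) (c (b e)) => -[] // _; case: (c _) => /=; ring.
(* The two ends of an edge have opposite signs, so their difference is 2 or -2 and the equation at
   vertex 0 becomes [2 l = 0]. *)
have xI (l : 'rV_m) : (row_mx 1%:M x *m I 'Z_N *m diag_mx l == 0) = (l *+ 2 == 0).
  have xIe e : (row_mx 1%:M x *m I 'Z_N *m diag_mx l) 0 e =
      (-1) ^+ (c (a e) (+) c (lshift n 0)) * (l *+ 2) 0 e.
    rewrite mul_mx_diag mxE mul_signed !x_eq mulmxnE.
    have := cc e; case: (c (a e)) (c (b e)) => -[] // _; case: (c _) => /=; ring.
  apply/eqP/eqP => l0; apply/rowP => e; last by rewrite xIe l0 !mxE mulr0.
  by rewrite -[LHS](signrMK (c (a e) (+) c (lshift n 0))) -xIe l0 !mxE mulr0.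
rewrite mulnC -card_alternating -card_2torsion -cardsX.
apply: (card_eq_bij (f := fun w => (inc_flow a b w *m Z'^T, M' *m w *m M'^T))).
- move=> w wK; have [aw Dw] := inc_formsP neq_ab w wK.
  rewrite !inE /= alternating_congr // andbT -mulmxMnl.
  suff /eqP -> : inc_flow a b w *+ 2 == 0 by rewrite mul0mx.
  by rewrite -xI -mulmxA -Dw mulmxA xD mul0mx.
- move=> w w' wK w'K [e1 e2]; apply/eqP; rewrite -subr_eq0; apply/eqP.
  apply: (inc_forms_eq0 cD cI); first exact: inc_formsB.
    by rewrite inc_flowB mulmxBl e1 subrr.
  by rewrite mulmxBr mulmxBl e2 subrr.
move=> [z w0]; rewrite !inE /= => /andP[/eqP z2 aw0].
have zI := circ_param cI z.
have [w [aw Pw Mw]] := alternating_solve cD (alternating_dsub_incidence zI) aw0.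
have Dw : D 'Z_N *m w = I 'Z_N *m diag_mx (z *m Z^T).
  apply: (@inc_forms_row0 _ _ _ _ _ _ _ x) => //; rewrite -/(D _) -/(I _) xD mul0mx.
  by apply/esym/eqP; rewrite xI -mulmxMnl z2 mul0mx.
exists w; last by rewrite (inc_flow_eq neq_ab Dw) (circ_paramK cI) Mw.
by apply/inc_formsP => //; rewrite (inc_flow_eq neq_ab Dw).
Qed.

Lemma map_mx_intz k l (A : 'M[int]_(k, l)) : map_mx (intr : int -> int) A = A.
Proof. by apply/matrixP => i j; rewrite mxE intz. Qed.

(** * Non-bipartite graphs: the relation at vertex 0 and its half *)

Section Odd.
Hypothesis odd_kernel : forall q (y : 'rV[int]_(1 + n)), dvdmx q (y *m D int) ->
  forall u, (q %| 2 * y 0%R u)%Z.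

Variables (s : nat) (P' : 'M[int]_(m, n)) (M : 'M[int]_(m, s)) (M' : 'M[int]_(s, m)).
Hypothesis cD : complementary (dsubmx (D int)) P' M M'.
Variables (Q' : 'M[int]_(m, n)) (Z : 'M[int]_(m, s)) (Z' : 'M[int]_(s, m)).
Hypothesis cI : complementary (dsubmx (I int)) Q' Z Z'.

(* [root_comb] are the coefficients making the combination [delta_0 + sum_u x_u
   delta_u] orthogonal to [P'], i.e. supported on the complementary basis vectors
   [M']; its coordinates there are even, as [sum_u delta_u] is twice the all-ones
   vector. *)
Definition odd_vec : 'rV[int]_s := const_mx 1 *m M.
Definition root_comb : 'rV[int]_n := - (usubmx (D int) *m P').
Definition half_flow : 'rV[int]_m := odd_vec *m M' -
  \row_e (row_mx 1%:M root_comb : 'rV_(1 + n)) 0 (b e).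

Lemma root_comb_unsigned : row_mx 1%:M root_comb *m D int = (odd_vec *+ 2) *m M'.
Proof.
have [e1 e2 e3 e4 e5] := cD.
have -> : odd_vec *+ 2 = usubmx (D int) *m M.
  (* Every row of [D] except row 0 is killed by [M], so summing all rows leaves row 0. *)
  have : (const_mx 1 : 'rV_(1 + n)) *m D int *m M = usubmx (D int) *m M.
    rewrite -{1}[D int]vsubmxK (_ : const_mx 1 = row_mx 1%:M (const_mx 1)).
      by rewrite mul_row_col mul1mx mulmxDl -mulmxA e2 mulmx0 addr0.
    apply/rowP => j; case: (split_ordP j) => i ->; rewrite ?row_mxEl ?row_mxEr !mxE //.
    by rewrite !ord1.
  move=> <-; rewrite -mulmxMnl; congr (_ *m _).
  by apply/rowP => e; rewrite mul_unsigned mulmxnE !mxE.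
rewrite -{1}[D int]vsubmxK mul_row_col mul1mx mulNmx -!mulmxA -{1}[usubmx _]mulmx1 -e5.
by rewrite mulmxDr addrAC subrr add0r.
Qed.

(** The difference of the coefficients at the two ends of an edge is their sum minus twice the
    coefficient at [b e], and the sum is even by [root_comb_unsigned]. *)
Lemma root_comb_signed : row_mx 1%:M root_comb *m I int = half_flow *+ 2.
Proof.
apply/rowP => e; rewrite mul_signed mulmxnE.
have -> : half_flow 0 e =
    (odd_vec *m M') 0 e - (row_mx 1%:M root_comb : 'rV_(1 + n)) 0 (b e).
  by rewrite [LHS]mxE; congr (_ + _); rewrite !mxE.
have /rowP/(_ e) := root_comb_unsigned.
by rewrite mul_unsigned mulmxMnl mulmxnE mulrnBl => <-; rewrite mulr2n; ring.
Qed.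

(** If [q] divides [y odd_vec], then [2 q] divides the combination of the [delta_u] with
    coefficients [y (1, root_comb)]. The odd cycle, through [odd_kernel], makes [2 q] divide twice
    its coefficient at vertex 0, which is [2 y]. *)
Lemma primitive_odd_vec : primitive_mx odd_vec.
Proof.
move=> q y qy; have /odd_kernel : dvdmx (q * 2) (y *m row_mx 1%:M root_comb *m D int).
  rewrite -mulmxA root_comb_unsigned mulmxMnl mulmxMnr mulmxA.
  have /dvdmxP qyM := dvdmx_mulr M' qy; apply/dvdmxP => i j.
  by rewrite mulmxnE -[X in (_ %| X)%Z]mulr_natr; apply: dvdz_mul.
move/(_ (lshift n 0)); rewrite mul_mx_row row_mxEl mulmx1 (mulrC q) dvdz_mul2l // => qy0.
by apply/dvdmxP => i j; rewrite !ord1.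
Qed.

(** Evaluating the alternating form [I diag(l) D^T] on [(1, root_comb)] gives 0, and that value is 4
    times the wanted one. Cancelling the 4 requires the integers, so [z] is lifted and the identity
    is reduced afterwards. *)
Lemma odd_vec_flow (R : comNzRingType) (z : 'rV[R]_s) :
  (forall x : R, exists k : int, x = k%:~R) ->
  map_mx intr half_flow *m diag_mx (z *m (map_mx intr Z)^T) *m (map_mx intr M')^T *m
    (map_mx intr odd_vec)^T = 0.
Proof.
move=> surj; have [z0 ->] : exists z0 : 'rV[int]_s, z = map_mx intr z0.
  have [f fP] := fin_all_exists (fun i => surj (z 0 i)).
  by exists (\row_i f i); apply/rowP => i; rewrite !mxE.
rewrite !map_trmx -!map_mxM -map_diag_mx -!map_mxM.
suff -> : half_flow *m diag_mx (z0 *m Z^T) *m M'^T *m odd_vec^T = 0 by rewrite map_mx0.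
have /(alternating_incidence neq_ab)/(alternating_congr (row_mx 1%:M root_comb)) :=
  circ_param cI z0.
move/alternating1; rewrite -/(D _) -/(I _) !mulmxA root_comb_signed -mulmxA.
rewrite -trmx_mul root_comb_unsigned !mulmxMnl [(_ *+ 2)^T]raddfMn /= mulmxMnr.
rewrite trmx_mul !mulmxA -mulrnA => /matrixP h.
apply/matrixP => i j; have /eqP := h i j.
by rewrite mulmxnE [X in _ == X -> _]mxE mulrn_eq0 /= => /eqP ->; rewrite mxE.
Qed.
End Odd.

(** The equation at vertex 0 reads [2 g M' w = 2 h diag(l)]: it fixes, up to 2-torsion, the row at
    [g] of the form [M' w M'^T]. A form is thus given by its circulation ([s] coordinates), the
    2-torsion discrepancy [rho] of that row against the [t] vectors of [G'], and an alternating form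
    on [G']. *)
Lemma card_inc_forms_nonbipartite (R : finComNzRingType) s t
    P' (M : 'M[R]_(m, s)) M' (cD : complementary (dsubmx (D R)) P' M M')
    Q' (Z : 'M[R]_(m, s)) Z' (cI : complementary (dsubmx (I R)) Q' Z Z')
    (g : 'rV[R]_s) g' (G : 'M[R]_(s, t)) G' (cg : complementary g g' G G')
    (x : 'rV[R]_n) (h : 'rV[R]_m) :
  row_mx 1%:M x *m D R = g *+ 2 *m M' ->
  row_mx 1%:M x *m I R = h *+ 2 ->
  (forall z : 'rV[R]_s, h *m diag_mx (z *m Z^T) *m M'^T *m g^T = 0) ->
  #|inc_forms a b R| =
    (#|R| ^ s * #|[set r : 'rV[R]_t | r *+ 2 == 0%R]| * #|R| ^ 'C(t, 2))%N.
Proof.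
move=> xD xI hg; rewrite -card_alternating -[s]mul1n -card_mx -cardsT -!cardsX.
pose flow w := inc_flow a b w *m Z'^T.
pose rho w := g *m M' *m w *m M'^T *m G'^T - h *m diag_mx (inc_flow a b w) *m M'^T *m G'^T.
pose rest w := G' *m (M' *m w *m M'^T) *m G'^T.
apply: (card_eq_bij (f := fun w => (flow w, rho w, rest w))).
- move=> w wK; have [aw Dw] := inc_formsP neq_ab w wK.
  rewrite !inE /= !alternating_congr // andbT.
  have e : (g *m M' *m w) *+ 2 = (h *m diag_mx (inc_flow a b w)) *+ 2.
    by rewrite -!mulmxMnl -xD -xI -!mulmxA Dw.
  by rewrite /rho -!mulmxBl -!mulmxMnl mulrnBl e subrr !mul0mx.
- move=> w w' wK w'K [e1 e2 e3]; apply/eqP; rewrite -subr_eq0; apply/eqP.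
  have flB := inc_flowB a b w w'.
  have {e1} e1 : flow (w - w') = 0.
    by rewrite /flow flB mulmxBl; apply/eqP; rewrite subr_eq0 -/(flow w) e1.
  have {e2} e2 : rho (w - w') = 0.
    rewrite /rho flB [diag_mx (_ - _)]raddfB !mulmxBr !mulmxBl.
    have /eqP := e2; rewrite -subr_eq0 => /eqP <-; rewrite /rho.
    by rewrite !opprB addrACA [RHS]addrACA [in LHS](addrC (- _) (- _)).
  have {e3} e3 : rest (w - w') = 0.
    by rewrite /rest mulmxBr !mulmxBl mulmxBr mulmxBl; apply/eqP; rewrite subr_eq0 -/(rest w) e3.
  move: (w - w') (inc_formsB neq_ab wK w'K) e1 e2 e3 => {flB wK w'K} {}w wK e1 e2 e3.
  have [aw _] := inc_formsP neq_ab w wK.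
  apply: (inc_forms_eq0 cD cI) => //; apply: (alternating_eq0 cg) => //.
    exact: alternating_congr.
  have [_ _ _ _ e5] := cg; have aw' := alternating_congr M' aw.
  have wg := alternating1 (alternating_congr g aw').
  rewrite /rho (circ_eq0 cI (inc_flow_circ neq_ab wK) e1) in e2.
  rewrite [diag_mx 0]raddf0 mulmx0 !mul0mx subr0 in e2.
  rewrite -[LHS]mulmx1 -trmx1 -e5 linearD /= !trmx_mul mulmxDr !(mulmxA _ _^T).
  by rewrite wg -!(mulmxA g) -!(mulmxA M') !(mulmxA M') !(mulmxA g) e2 !mul0mx addr0.
move=> [[z r] w0]; rewrite !inE /= => /andP[/eqP r2 aw0].
have [g1 g2 g3 g4 g5] := cg; have [d1 d2 d3 d4 d5] := cD.
pose l := z *m Z^T; have lI : l *m (I R)^T = 0 := circ_param cI z.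
(* The row that the remaining form must have at [g], in coordinates against [G']. By [hg] the term
   [h diag(l) M'^T] is recovered from these coordinates. *)
pose r' := r + h *m diag_mx l *m M'^T *m G'^T.
have r'g : r' *m G^T *m g^T = 0 by rewrite -mulmxA -trmx_mul g2 trmx0 mulmx0.
have [w1 [aw1 gw1 Gw1]] : exists w1,
    [/\ alternating w1, g *m w1 = r' *m G^T & G' *m w1 *m G'^T = w0].
  by apply: (alternating_solve cg) => //; rewrite r'g alternating0.
have [w [aw Pw Mw]] := alternating_solve cD (alternating_dsub_incidence lI) aw1.
have Dw : D R *m w = I R *m diag_mx l.
  apply: (@inc_forms_row0 _ _ _ _ _ _ _ x) => //; rewrite -/(D _) -/(I _).
  (* The equation is tested against the basis formed by the rows of [dsubmx (D R)] and of [M']. On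
     the former it follows from the equations at the other vertices and the antisymmetry of
     [I diag(l) D^T]; on the latter it is twice the choice of [r']. *)
  have e : (dsubmx (D R))^T *m P'^T + M'^T *m M^T = 1%:M.
    by rewrite -!trmx_mul -linearD /= d5 trmx1.
  rewrite -[LHS]mulmx1 -[RHS]mulmx1 -e !mulmxDr !mulmxA; congr (_ + _); congr (_ *m _).
    have sub k (A : 'M[R]_(k, m)) (B : 'M[R]_(1 + n, m)) :
        A *m (dsubmx B)^T = rsubmx (A *m B^T).
      by rewrite -{2}[B]vsubmxK tr_col_mx mul_mx_row row_mxKr.
    rewrite -[w]opprK -(alternating_tr aw) mulmxN mulNmx -mulmxA -trmx_mul Pw.
    rewrite trmx_mul tr_diag_mx mulmxA -(mulmxA _ (D R)) -mulmxA sub.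
    have /alternating_tr := introT (alternating_incidence neq_ab l) lI.
    rewrite !trmx_mul trmxK tr_diag_mx mulmxA -/(D R) -/(I R) => sk.
    by rewrite -(mulmxA (row_mx _ _)) sk mulmxN raddfN /= opprK !mulmxA sub -!mulmxA.
  rewrite xD xI !mulmxMnl -!(mulmxA g) -!(mulmxA M') (mulmxA M') Mw gw1.
  rewrite -[LHS]mulmxMnl /r' mulrnDl r2 add0r mulmxMnl; congr (_ *+ 2).
  rewrite -[RHS]mulmx1 -trmx1 -g5 linearD /= !trmx_mul mulmxDr !(mulmxA _ _^T).
  by rewrite hg mul0mx add0r.
have fl := inc_flow_eq neq_ab Dw.
exists w; first by apply/inc_formsP => //; rewrite fl.
rewrite /flow /rho /rest fl Mw Gw1 (circ_paramK cI).
rewrite -!(mulmxA g) -(mulmxA M' w) (mulmxA M') Mw mulmxA gw1.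
by rewrite -(mulmxA r') -trmx_mul g4 trmx1 mulmx1 addrK.
Qed.

Lemma card_inc_forms_odd N :
  (forall q (y : 'rV[int]_(1 + n)), dvdmx q (y *m D int) ->
     forall u, (q %| 2 * y 0%R u)%Z) ->
  (n < m)%N /\
  #|inc_forms a b 'Z_N| =
    (#|'Z_N| ^ ('C(m - n, 2) + 1) * num_ann N 2 ^ (m - n - 1))%N.
Proof.
move=> odd; have [_ [P' [M [M' cD]]]] := unsigned_complement.
have [_ [Q' [Z [Z' cI]]]] := signed_complement.
have cDz := cD int; have cIz := cI int; rewrite !map_mx_intz in cDz cIz.
have [t [g' [G [G' [et cg]]]]] := primitive_complementary (primitive_odd_vec odd cDz).
have xD := root_comb_unsigned cDz; have xI := root_comb_signed cDz.
have hg := odd_vec_flow cDz cIz.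
split; first lia.
have surj (x : 'Z_N) : exists k : int, x = k%:~R by exists (x : nat)%:Z; rewrite -pmulrn natr_Zp.
have {}xD : row_mx 1%:M (map_mx intr (root_comb P')) *m D 'Z_N =
    map_mx intr (odd_vec M) *+ 2 *m map_mx intr M'.
  rewrite /D -(map_unsigned a b (intr : {rmorphism int -> 'Z_N})).
  rewrite -(map_mx1 (intr : {rmorphism int -> 'Z_N})) -map_row_mx -map_mxM xD.
  by rewrite map_mxM [map_mx _ (_ *+ 2)]raddfMn.
have {}xI : row_mx 1%:M (map_mx intr (root_comb P')) *m I 'Z_N =
    map_mx intr (half_flow P' M M') *+ 2.
  rewrite /I -(map_signed a b (intr : {rmorphism int -> 'Z_N})).
  rewrite -(map_mx1 (intr : {rmorphism int -> 'Z_N})) -map_row_mx -map_mxM xI.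
  by rewrite [map_mx _ (_ *+ 2)]raddfMn.
have cgN := complementary_map (intr : {rmorphism int -> 'Z_N}) cg.
rewrite (card_inc_forms_nonbipartite (cD _) (cI _) cgN xD xI) => [|z]; last exact: hg.
rewrite card_2torsion (_ : m - n - 1 = t)%N; last lia.
(* With [p1 = t + 1], the exponent [p1 + C(t, 2)] equals [C(p1, 2) + 1]. *)
rewrite mulnAC -expnD; congr (_ ^ _ * _)%N.
by rewrite et binS bin1; lia.
Qed.

End Counting.

(** * Homology of integer matrices *)

Lemma homology_iso (A B C T : zmodType) (f : {additive A -> B}) (g : {additive B -> C})
    (phi : B -> T) :
  zmod_morphism phi ->
  (forall t, exists z, g z = 0 /\ phi z = t) ->
  (forall z, g z = 0 -> (phi z = 0 <-> exists a, f a = z)) ->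
  zmod_iso (homology f g) T.
Proof.
move=> phiB phiS phiK; pose F (q : homology f g) : T := phi (cycle_val (repr q)).
have gz (z : cycles g) : g (cycle_val z) = 0 by case: z => z /= /eqP.
have cvB (x y : cycles g) : cycle_val (x - y) = cycle_val x - cycle_val y.
  exact: (raddfB (val : cycles g -> B)).
have F_pi (z : cycles g) : F (\pi_(homology f g) z)%qT = phi (cycle_val z).
  have : repr (\pi_(homology f g) z)%qT - z \in boundary_pred f (g := g).
    by rewrite Quotient.idealrBE reprK.
  rewrite unfold_in => /asboolP/phiK; rewrite gz => /(_ erefl)/eqP.
  by rewrite cvB phiB subr_eq0 => /eqP.
have FB : zmod_morphism F.
  move=> x y; rewrite -[x]reprK -[y]reprK -raddfB !F_pi -phiB.
  by rewrite cvB.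
pose F' := HB.pack_for {additive homology f g -> T} F
  (GRing.isZmodMorphism.Build _ _ F FB).
exists F'; have FI : injective F.
  move=> x y /eqP; rewrite -subr_eq0 -FB => /eqP; rewrite -[x]reprK -[y]reprK -raddfB F_pi.
  move=> /phiK; rewrite gz => /(_ erefl) h; apply/eqP.
  by rewrite -Quotient.idealrBE unfold_in; apply/asboolP.
have FS t : exists q, F q == t.
  have [z [z0 <-]] := phiS t.
  exists (\pi_(homology f g) (Cycle (introT eqP z0 : z \in cycle_pred g)))%qT.
  by rewrite F_pi.
exists (fun t => xchoose (FS t)) => [q|t]; last exact/eqP/(xchooseP (FS t)).
by apply: FI; apply/eqP/(xchooseP (FS (F q))).
Qed.

Definition Smith_form n1 n2 (B : 'M[int]_(n1, n2)) r s1 s2 a :=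
  exists (L : 'M_(n1, r)) (L' : 'M_(r, n1)) (M : 'M_(n1, s1)) (M' : 'M_(s1, n1))
    (P : 'M_(r, n2)) (P' : 'M_(n2, r)) (N : 'M_(n2, s2)) (N' : 'M_(s2, n2)) (d : 'rV_r),
  [/\ B = L *m diag_mx d *m P, complementary L' L M M', complementary P P' N N',
      forall i, (`|d 0%R i| == 1)%N || (`|d 0%R i| == 2)%N
    & #|[set i | `|d 0%R i| == 2]%N| = a].

Lemma Smith_form_tr n1 n2 (B : 'M[int]_(n1, n2)) r s1 s2 a :
  Smith_form B r s1 s2 a -> Smith_form B^T r s2 s1 a.
Proof.
case=> L [L' [M [M' [P [P' [N [N' [d [-> cL cP d12 da]]]]]]]]].
exists P^T, P'^T, N'^T, N^T, L^T, L'^T, M'^T, M^T, d; split=> //.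
- by rewrite !trmx_mul tr_diag_mx mulmxA.
- exact: complementary_tr.
- exact: complementary_tr.
Qed.

(** This keeps the quotient type out of the matrix computations; [homology_rows] returns to it. *)
Definition row_homology n1 n2 n3 (A : 'M[int]_(n1, n2)) (B : 'M[int]_(n2, n3)) (T : zmodType) :=
  exists phi : 'rV[int]_n2 -> T,
    [/\ zmod_morphism phi, forall t, exists z, z *m B = 0 /\ phi z = t
      & forall z, z *m B = 0 -> (phi z = 0 <-> exists x, x *m A = z)].

Section MatrixHomology.
Variables (n0 n1 n2 n3 r s1 s2 a : nat).
Variables (A : 'M[int]_(n0, n1)) (B : 'M[int]_(n1, n2)) (C : 'M[int]_(n2, n3)).
Hypothesis SB : Smith_form B r s1 s2 a.

(** The left kernel of [B] has the rows of [M'] as a basis. In these coordinates [A] becomes [A M],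
    still primitive, so the quotient is free on a complement. *)
Lemma row_homology_free : primitive_mx A -> A *m B = 0 ->
  exists h, s1 = (n0 + h)%N /\ row_homology A B 'rV[int]_h.
Proof.
case: SB => L [L' [M [M' [P [P' [N [N' [d [eB cL cP d12 _]]]]]]]]] primA AB.
have [e1 e2 e3 e4 e5] := cL; have [f1 f2 f3 f4 f5] := cP.
have dinj k (x : 'M_(k, r)) : x *m diag_mx d = 0 -> x = 0.
  move=> /matrixP h; apply/matrixP => i j; have := h i j.
  rewrite mul_mx_diag !mxE => /eqP; rewrite mulf_eq0 => /orP[/eqP//|/eqP dj].
  by have := d12 j; rewrite dj.
have kerB k (x : 'M_(k, n1)) : x *m B = 0 <-> x *m L = 0.
  rewrite eB !mulmxA; split=> [h|->]; last by rewrite !mul0mx.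
  by apply: dinj; rewrite -[LHS]mulmx1 -f1 mulmxA h mul0mx.
have AL := (kerB _ A).1 AB.
have AM : A = A *m M *m M'.
  by rewrite -[LHS]mulmx1 -e5 mulmxDr !mulmxA AL mul0mx add0r.
have primA' : primitive_mx (A *m M).
  move=> q x qx; apply: primA; suff -> : x *m A = x *m (A *m M) *m M' by apply: dvdmx_mulr.
  by rewrite {1}AM !mulmxA.
have [h [A' [K [K' [es [k1 k2 k3 k4 k5]]]]]] := primitive_complementary primA'.
exists h; split=> //; exists (fun z => z *m M *m K); split.
- by move=> x y; rewrite !mulmxBl.
- move=> t; exists (t *m K' *m M'); split.
    by apply/kerB; rewrite -mulmxA e3 mulmx0.
  by rewrite -(mulmxA _ M') e4 mulmx1 -mulmxA k4 mulmx1.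
move=> z /kerB zL; split=> [z0|[x <-]]; last first.
  by rewrite -!mulmxA (mulmxA A) k2 mulmx0.
have zM : z *m M = z *m M *m A' *m (A *m M).
  rewrite -[LHS]mulmx1 -k5 mulmxDr [z *m M *m (K *m _)]mulmxA z0 mul0mx addr0.
  by rewrite !mulmxA.
exists (z *m M *m A').
rewrite -[RHS]mulmx1 -e5 mulmxDr mulmxA zL mul0mx add0r mulmxA [in RHS]zM {1}AM.
by rewrite !mulmxA.
Qed.

(** The rows of [P] lie in the left kernel of [C], whereas the image of [B] is spanned by their
    multiples by the [d_i]: this yields one Z/2 for each [d_i] of absolute value 2. The rest of the
    kernel is a complement of the primitive [N' C], hence free. *)
Lemma row_homology_torsion : primitive_mx C^T -> B *m C = 0 ->
  exists h, s2 = (n3 + h)%N /\ row_homology B C ('rV['Z_2]_a * 'rV[int]_h)%type.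
Proof.
case: SB => L [L' [M [M' [P [P' [N [N' [d [eB cL cP d12 <-]]]]]]]]] primC BC.
have [e1 e2 e3 e4 e5] := cL; have [f1 f2 f3 f4 f5] := cP.
have dn0 i : d 0 i != 0 by apply: contraTneq (d12 i) => ->.
have PC : P *m C = 0.
  have : diag_mx d *m (P *m C) = 0.
    rewrite -[LHS]mul1mx -e1 -!mulmxA [L *m (_ *m _)]mulmxA [L *m _ *m _]mulmxA -eB BC.
    by rewrite mulmx0.
  move=> /matrixP h; apply/matrixP => i j; have /eqP := h i j.
  by rewrite mul_diag_mx mxE [X in _ == X]mxE mulf_eq0 (negbTE (dn0 i)) [RHS]mxE => /eqP.
have CN : C = N *m N' *m C by rewrite -[LHS]mul1mx -f5 mulmxDl -!mulmxA PC mulmx0 add0r.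
have primC' : primitive_mx (N' *m C)^T.
  move=> q x qx; apply: primC.
  suff -> : x *m C^T = x *m (N' *m C)^T *m N^T by apply: dvdmx_mulr.
  by rewrite -mulmxA -trmx_mul mulmxA -CN.
have [h [E [K [K' [es [k1 k2 k3 k4 k5]]]]]] := primitive_complementary primC'.
pose J := [set i | `|d 0%R i| == 2]%N.
(* Only the coordinates in [J] are kept: at the others [d_i] is a unit and the quotient is
   trivial. *)
pose red (w : 'rV[int]_r) : 'rV['Z_2]_#|J| := \row_j (w 0 (enum_val j))%:~R.
have redB x y : red (x - y) = red x - red y by apply/rowP => j; rewrite !mxE rmorphB.
have red0 w : red w = 0 <-> exists v, w = v *m diag_mx d.
  have even (x : int) : (x%:~R : 'Z_2) = 0 <-> (2 %| x)%Z.
    split=> [|/dvdzP[k ->]]; last first.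
      by rewrite rmorphM /= [X in _ * X](_ : _ = 0) ?mulr0 //; apply/val_inj.
    move=> x0; have : (`|x|%N%:R : 'Z_2) = 0.
      by case: (intP x) x0 => // n; rewrite abszN absz_nat mulrNz -pmulrn => /eqP;
          rewrite oppr_eq0 => /eqP.
    rewrite -Zp_nat_mod // => /(congr1 val) /=.
    by rewrite /= val_Zp_nat // modn_mod => /eqP; rewrite dvdzE.
  split=> [/rowP w0|[v ->]]; last first.
    apply/rowP => j; rewrite mul_mx_diag !mxE; apply/even.
    by rewrite dvdz_mull // dvdzE; have := enum_valP j; rewrite inE => /eqP ->.
  exists (\row_i (w 0%R i %/ d 0%R i)%Z); apply/rowP => i; rewrite mul_mx_diag !mxE divzK //.
  rewrite dvdzE; case/orP: (d12 i) => /eqP di; rewrite di ?dvd1n //.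
  have iJ : i \in J by rewrite inE di.
  have := w0 (enum_rank_in iJ i); rewrite !mxE enum_rankK_in // => /even.
  by rewrite dvdzE.
exists h; split=> //; exists (fun z => (red (z *m P'), z *m N *m K'^T)); split.
- by move=> x y; rewrite !mulmxBl redB.
- move=> [u t].
  (* A lift of [u]: its representatives at the places in [J], and 0 elsewhere. *)
  pose w : 'rV[int]_r := \row_i \sum_j (u 0 j : nat)%:Z *+ (enum_val j == i).
  exists (w *m P + t *m K^T *m N'); split.
    rewrite mulmxDl -!mulmxA PC mulmx0 add0r -[N' *m C]trmxK -trmx_mul k2 trmx0.
    by rewrite mulmx0.
  have -> : (w *m P + t *m K^T *m N') *m P' = w.
    by rewrite mulmxDl -!mulmxA f1 f3 !mulmx0 mulmx1 addr0.
  have -> : (w *m P + t *m K^T *m N') *m N = t *m K^T.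
    by rewrite mulmxDl -!mulmxA f2 f4 mulmx0 mulmx1 add0r.
  rewrite -mulmxA -trmx_mul k4 trmx1 mulmx1.
  congr (_, _); apply/rowP => j; rewrite !mxE (bigD1 j) //= eqxx big1 ?addr0 => [|j' /negbTE nj].
    by rewrite -pmulrn natr_Zp.
  by rewrite (inj_eq enum_val_inj) nj.
move=> z zC; have zNC : z *m N *m (N' *m C) = 0 by rewrite -zC {2}CN !mulmxA.
split=> [[/red0[v zP] zN]|[x <-]].
  have zN0 : z *m N = 0.
    have k5' : (N' *m C) *m E^T + K'^T *m K^T = 1%:M.
      by rewrite -[N' *m C]trmxK -!trmx_mul -linearD /= k5 trmx1.
    rewrite -[LHS]mulmx1 -k5' mulmxDr (mulmxA (z *m N) (N' *m C)) zNC mul0mx.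
    by rewrite (mulmxA _ K'^T) zN mul0mx addr0.
  exists (v *m L'); rewrite eB !mulmxA -(mulmxA v L') e1 mulmx1 -zP.
  by rewrite -[RHS]mulmx1 -f5 mulmxDr !mulmxA zN0 mul0mx addr0.
have -> : x *m B *m N = 0 by rewrite eB -!mulmxA f2 !mulmx0.
have -> : x *m B *m P' = x *m L *m diag_mx d by rewrite eB -!mulmxA f1 mulmx1.
by rewrite mul0mx; congr (_, _); apply/red0; exists (x *m L).
Qed.
End MatrixHomology.

(** * Cochains and chains as integer row vectors *)

Section Rows.
Variables (G : sgraph) (le : rel {set G}).

Definition diff_mx i i' j : 'M[int]_(#|gen G i j|, #|gen G i' j|) :=
  \matrix_(x, y) diff_coef le (val (enum_val x)) (val (enum_val y)).

Definition cochain_row i j (z : cochain G i j) : 'rV[int]_#|gen G i j| :=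
  \row_x z (enum_val x).

Lemma cochain_row_inj i j : injective (@cochain_row i j).
Proof.
move=> y z /rowP h; apply/ffunP => b; have := h (enum_rank b).
by rewrite !mxE enum_rankK.
Qed.

Lemma cochain_row_surj i j (r : 'rV_#|gen G i j|) : exists z, cochain_row z = r.
Proof.
exists [ffun b => r 0 (enum_rank b)]; apply/rowP => x.
by rewrite !mxE ffunE enum_valK.
Qed.

Lemma cochain_rowB i j : zmod_morphism (@cochain_row i j).
Proof. by move=> y z; apply/rowP => x; rewrite !mxE !ffunE. Qed.

Lemma diff_row i i' j (z : cochain G i j) :
  cochain_row (diff le i' z) = cochain_row z *m diff_mx i i' j.
Proof.
apply/rowP => y; rewrite !mxE ffunE (reindex_onto _ _ (fun b _ => enum_rankK b)) /=.
apply: eq_big => [x|x _]; first by rewrite enum_valK eqxx.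
by rewrite !mxE.
Qed.

Definition cochain_delta i j (b : gen G i j) : cochain G i j := [ffun b' => (b' == b)%:R].

Definition chain_row i j (f : chain G i j) : 'rV[int]_#|gen G i j| :=
  \row_x f (cochain_delta (enum_val x)).

Lemma chain_expand i j (f : chain G i j) (z : cochain G i j) :
  f z = \sum_b z b * f (cochain_delta b).
Proof.
have {1}-> : z = \sum_b (z b : int) *: cochain_delta b.
  apply/ffunP => b0; have ev := big_morph (fun y : cochain G i j => y b0 : int).
  rewrite (ev 0 +%R); [|by move=> u w; rewrite ffunE|by rewrite ffunE].
  transitivity (\sum_b (z b : int) * (b0 == b)%:R); last first.
    by apply: eq_bigr => b _; rewrite !ffunE.
  rewrite (bigD1 b0) //= eqxx mulr1 big1 ?addr0 // => b' nb.
  by rewrite eq_sym (negbTE nb) mulr0.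
rewrite linear_sum; apply: eq_bigr => b _; exact: linearZ.
Qed.

Lemma chain_row_inj i j : injective (@chain_row i j).
Proof.
move=> f g /rowP h; apply/lfunP => z; rewrite !chain_expand.
by apply: eq_bigr => b _; have := h (enum_rank b); rewrite !mxE enum_rankK => ->.
Qed.

Lemma chain_row_surj i j (r : 'rV_#|gen G i j|) : exists f, chain_row f = r.
Proof.
pose f (z : cochain G i j) : int^o := \sum_b z b * r 0 (enum_rank b).
have fL : linear f.
  move=> a u w; rewrite /f scaler_sumr -big_split /=; apply: eq_bigr => b _.
  by rewrite !ffunE mulrDl -scalerAl.
pose f' := HB.pack_for {linear cochain G i j -> int^o} f
  (GRing.isLinear.Build int (cochain G i j) int^o *:%R f fL).
exists (linfun f'); apply/rowP => x; rewrite mxE lfunE /= /f (bigD1 (enum_val x)) //=.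
rewrite ffunE eqxx mul1r enum_valK big1 ?addr0 // => b /negbTE nb.
by rewrite ffunE nb mul0r.
Qed.

Lemma chain_rowB i j : zmod_morphism (@chain_row i j).
Proof. by move=> f g; apply/rowP => x; rewrite !mxE !lfunE /= lfunE. Qed.

Lemma bdiff_row i i' j (f : chain G i j) :
  chain_row (bdiff le i' f) = chain_row f *m (diff_mx i' i j)^T.
Proof.
apply/rowP => x; rewrite !mxE /bdiff comp_lfunE lfunE /= chain_expand.
rewrite (reindex_onto _ _ (fun b _ => enum_rankK b)) /=.
apply: eq_big => [y|y _]; first by rewrite enum_valK eqxx.
rewrite !mxE ffunE mulrC; congr (_ * _).
rewrite (bigD1 (enum_val x)) //= ffunE eqxx mul1r big1 ?addr0 // => b /negbTE nb.
by rewrite ffunE nb mul0r.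
Qed.

Lemma homology_rows (A B C T : zmodType) (f : {additive A -> B}) (g : {additive B -> C})
    n1 n2 n3 (F : 'M[int]_(n1, n2)) (H : 'M[int]_(n2, n3))
    (rA : A -> 'rV_n1) (rB : B -> 'rV_n2) (rC : C -> 'rV_n3) :
  (forall r, exists z, rA z = r) ->
  zmod_morphism rB -> injective rB -> (forall r, exists z, rB z = r) ->
  zmod_morphism rC -> injective rC ->
  (forall z, rB (f z) = rA z *m F) -> (forall z, rC (g z) = rB z *m H) ->
  row_homology F H T -> zmod_iso (homology f g) T.
Proof.
move=> sA mB iB sB mC iC rf rg [phi [mphi sphi kphi]].
have g0 z : g z = 0 <-> rB z *m H = 0.
  have rC0 : rC 0 = 0 by rewrite -[X in rC X](subrr 0) mC subrr.
  by rewrite -rg; split=> [->//|]; rewrite -rC0 => /iC.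
apply: (homology_iso (phi := phi \o rB)) => [x y|t|z /g0/kphi zk] /=.
- by rewrite mB mphi.
- have [r [r0 rt]] := sphi t; have [z zr] := sB r.
  by exists z; rewrite zr; split=> //; apply/g0; rewrite zr.
rewrite zk; split=> [[x xz]|[a az]].
  by have [a ax] := sA x; exists a; apply: iB; rewrite rf ax.
by exists (rA a); rewrite -rf az.
Qed.

(** The neighbouring degrees are variables tied by equations, so that the matrices can be indexed by
    numerals instead of terms such as [1 - 1]. *)
Lemma cohomology_rows i i0 i2 j T :
  row_homology (diff_mx i0 i j) (diff_mx i i2 j) T -> i0 = i - 1 -> i2 = i + 1 ->
  zmod_iso (cohomology le i j) T.
Proof.
move=> h e0 e2; rewrite e0 e2 in h.
by apply: homology_rows h; [exact: cochain_row_surj|exact: cochain_rowB|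
  exact: cochain_row_inj|exact: cochain_row_surj|exact: cochain_rowB|
  exact: cochain_row_inj|exact: diff_row|exact: diff_row].
Qed.

Lemma chomology_rows i i0 i2 j T :
  row_homology (diff_mx i i2 j)^T (diff_mx i0 i j)^T T -> i0 = i - 1 -> i2 = i + 1 ->
  zmod_iso (chomology le i j) T.
Proof.
move=> h e0 e2; rewrite e0 e2 in h.
by apply: homology_rows h; [exact: chain_row_surj|exact: chain_rowB|
  exact: chain_row_inj|exact: chain_row_surj|exact: chain_rowB|
  exact: chain_row_inj|exact: bdiff_row|exact: bdiff_row].
Qed.

End Rows.

(** * The complex in degree v - 2 *)

Section Complex.
Variables (G : sgraph) (le : rel {set G}).
Hypothesis le_order : linear_order_on (edges G) le.
Implicit Types (s : {set {set G}}) (e f K P : {set G}) (x y : G).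
Local Notation J := (#|G|%:Z - 2).

Lemma mul_diff_mx i k l (x : 'I_#|gen G i J|) (z : 'I_#|gen G l J|) :
  (diff_mx le i k J *m diff_mx le k l J) x z =
  \sum_(b | is_gen k J b) diff_coef le (val (enum_val x)) b * diff_coef le b (val (enum_val z)).
Proof.
rewrite mxE -(sum_gen k (fun b => diff_coef le (val (enum_val x)) b *
  diff_coef le b (val (enum_val z)))).
by apply: eq_bigr => y _; rewrite !mxE.
Qed.

(* [0] outside the generators. *)
Definition gen_fun (R : nmodType) i (r : 'I_#|gen G i J| -> R) (b : state G) : R :=
  if insub b is Some c then r (enum_rank c) else 0.

Lemma gen_funE (R : nmodType) i (r : 'I_#|gen G i J| -> R) (x : 'I_#|gen G i J|) :
  gen_fun r (val (enum_val x)) = r x.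
Proof. by rewrite /gen_fun valK enum_valK. Qed.

Lemma gen_index i b : is_gen i J b -> exists x : 'I_#|gen G i J|, val (enum_val x) = b.
Proof. by move=> h; exists (enum_rank (Sub b h : gen G i J)); rewrite enum_rankK. Qed.

Lemma row_mul_diff i k (r : 'rV_#|gen G i J|) (y : 'I_#|gen G k J|) :
  (r *m diff_mx le i k J) 0 y =
  \sum_(b | is_gen i J b) gen_fun (r 0) b * diff_coef le b (val (enum_val y)).
Proof.
rewrite mxE -(sum_gen i (fun b => gen_fun (r 0) b * diff_coef le b (val (enum_val y)))).
by apply: eq_bigr => x _; rewrite !mxE gen_funE.
Qed.

(* The component of [[G : {e}]] labelled [1] in the image of [state0 P] under the
   edge [e], provided that [e] meets [P]. *)
Definition residual P e := if P == e then e else P :\: e.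

Lemma residual_component P e : e \in edges G -> #|P| = 2 -> P :&: e != set0 ->
  residual P e \in components [set e].
Proof.
move=> eE P2 Pe; rewrite /residual; have e2 := card_edge eE.
have [_|nPe] := eqVneq P e.
  have [x [y [_ exy]]] := edge_pair eE.
  have xe : x \in e by rewrite exy !inE eqxx.
  by apply/componentsP; exists x; rewrite component_edge // xe.
have c1 : #|P :\: e| == 1%N.
  rewrite cardsD P2 eqn_leq; apply/andP; split.
    by rewrite leq_subLR addn1 ltnS card_gt0.
  rewrite subn_gt0 -P2 ltn_neqAle subset_leq_card ?subsetIl // andbT.
  apply: contraNneq nPe => h; rewrite eqEcard e2 P2 leqnn andbT.
  by apply/setIidPl/eqP; rewrite eqEcard subsetIl h leqnn.
have /cards1P[c Pc] := c1; rewrite Pc.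
have ce : c \notin e by have : c \in P :\: e; [rewrite Pc set11|rewrite inE => /andP[]].
by apply/componentsP; exists c; rewrite component_edge // (negbTE ce).
Qed.

(** The right-hand side is symmetric in [e] and [f], so the two orders of adding them to [state0]
    differ only by the sign. *)
Lemma residual_swap a b e f : a != b -> e \in edges G ->
  ([set a; b] :&: e != set0) && (residual [set a; b] e :&: f != set0) =
  (a \in e) && (b \in f) || (b \in e) && (a \in f).
Proof.
move=> nab eE; have e2 := card_edge eE.
have meet A : ([set a; b] :&: A != set0) = (a \in A) || (b \in A).
  apply/set0Pn/orP => [[x]|[xA|xA]].
  - by rewrite !inE => /andP[/orP[]/eqP -> ->]; [left|right].
  - by exists a; rewrite !inE eqxx.
  - by exists b; rewrite !inE eqxx orbT.
rewrite meet /residual; have [<-|ne] := eqVneq [set a; b] e.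
  by rewrite meet !inE !eqxx !orbT /= orbC.
have : ~~ ((a \in e) && (b \in e)).
  apply: contra ne => /andP[ae be]; rewrite eqEcard e2 cards2 nab andbT.
  by rewrite subUset !sub1set ae.
have single c (A : {set G}) : ([set c] :&: A != set0) = (c \in A).
  by rewrite setI_eq0 disjoints1 negbK.
have diff1 c d : c \in e -> d \notin e -> [set c; d] :\: e = [set d].
  move=> ce de; apply/setP => x; rewrite !inE; have [->|nxd] := eqVneq x d.
    by rewrite de orbT.
  by rewrite orbF; have [->|] := eqVneq x c; rewrite ?ce ?andbF.
case ae: (a \in e); case be: (b \in e) => //= _; rewrite ?orbF -single.
  by rewrite diff1 ?be.
by rewrite setUC diff1 ?ae.
Qed.

Lemma diff01_diff12 : diff_mx le 0 1 J *m diff_mx le 1 2 J = 0.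
Proof.
apply/matrixP => x z; rewrite mul_diff_mx sum_gen1 [RHS]mxE.
have /is_gen0P[P P2 ->] := valP (enum_val x).
have /is_gen2P[s [sE s2 ->]] := valP (enum_val z).
have /eqP/cards2P[a [b [nab Pab]]] := P2.
pose T e : int := (P :&: e != set0)%:R * diff_coef le (state1 e (residual P e)) (state2 s).
(* For each [e] at most one component of its one-edge graph can carry the label 1, namely
   [residual P e]. *)
transitivity (\sum_(e in edges G) T e).
  apply: eq_bigr => e eE; rewrite /T.
  have [Pe|Pe] := eqVneq (P :&: e) set0.
    by rewrite mul0r big1 // => K Kc; rewrite diff_coef01 // Pe eqxx mul0r.
  have rc := residual_component eE P2 Pe.
  rewrite (bigD1 (residual P e)) //= diff_coef01 // Pe eqxx /= big1 ?addr0 // => K.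
  case/andP=> Kc /negbTE nK; rewrite diff_coef01 // -/(residual P e) nK andbF.
  by rewrite mul0r.
have /eqP/cards2P[e [f [nef es]]] := s2.
have [eE fE] : e \in edges G /\ f \in edges G.
  by split; apply: (subsetP sE); rewrite es !inE eqxx ?orbT.
rewrite (bigD1 e) //= (bigD1 f) /=; last by rewrite fE eq_sym.
rewrite big1 => [|g /andP[/andP[gE nge] ngf]]; last first.
  rewrite /T diff_coef_sub0 ?mulr0 //= sub1set es !inE.
  by rewrite (negbTE nge) (negbTE ngf).
have Tef e' f' : e' \in edges G -> f' \in edges G -> f' != e' -> s = f' |: [set e'] ->
   T e' = ((P :&: e' != set0) && (residual P e' :&: f' != set0))%:R * edge_sign le [set e'] f'.
  move=> e'E f'E nfe se; rewrite /T se.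
  have [_|Pe] := eqVneq (P :&: e') set0; first by rewrite !mul0r.
  by rewrite mul1r diff_coef12 // residual_component.
rewrite (Tef e f) //; [|by rewrite eq_sym|by rewrite es setUC].
rewrite (Tef f e) // addr0 Pab !residual_swap // (edge_sign1_swap le_order eE fE nef).
rewrite (_ : _ || (_ && (a \in f)) = (a \in f) && (b \in e) || (b \in f) && (a \in e)).
  by rewrite mulrN ?addNr ?subrr.
by rewrite orbC ![_ && (_ \in f)]andbC.
Qed.

(** Only the two orders of adding the other edges [f] and [g] of the triple contribute. Their
    coefficients agree since [f] and [g] touch the same components by [touched_inner], and their
    signs are opposite. *)
Lemma diff12_diff23 : diff_mx le 1 2 J *m diff_mx le 2 3 J = 0.
Proof.
apply/matrixP => x z; rewrite mul_diff_mx sum_gen2 [RHS]mxE.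
have /is_gen1P[e [K [eE Kc ->]]] := valP (enum_val x).
have /is_gen3P[s [sE s3 cs ->]] := valP (enum_val z).
have [es|es] := boolP (e \in s); last first.
  apply: big1 => s2 _; have [e2|e2] := boolP (e \in s2).
    rewrite [X in _ * X]diff_coef_sub0 ?mulr0 //=; apply: contra es => /subsetP.
    exact.
  by rewrite [X in X * _]diff_coef_sub0 ?mul0r //= sub1set.
have s2 : #|s :\ e| = 2%N by move: s3; rewrite (cardsD1 e) es => -[].
have /eqP/cards2P[f [g [nfg efg]]] := s2.
have [fs nfe] : f \in s /\ f != e.
  by have : f \in s :\ e; [rewrite efg !inE eqxx|rewrite in_setD1 => /andP[]].
have [gs nge] : g \in s /\ g != e.
  by have : g \in s :\ e; [rewrite efg !inE eqxx orbT|rewrite in_setD1 => /andP[]].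
have [fE gE] := (subsetP sE _ fs, subsetP sE _ gs).
have sg h h' : h != h' -> s :\ e = [set h; h'] ->
    s = h' |: (h |: [set e]) /\ s :\ h' = h |: [set e].
  move=> nhh' eh; have es' : s = h' |: (h |: [set e]).
    by rewrite -(setD1K es) eh [RHS]setUA [in RHS](setUC [set h']) [RHS]setUC.
  split=> //; rewrite es' setU1K // !inE eq_sym negb_or nhh' /=.
  have : h' \in s :\ e by rewrite eh !inE eqxx orbT.
  by rewrite in_setD1 => /andP[].
have [sfg sDg] := sg _ _ nfg efg.
have [sgf sDf] := sg g f (etrans (congr1 negb (eq_sym _ _)) nfg) (etrans efg (setUC _ _)).
rewrite (bigID (fun s2 => e \in s2)) /= [X in _ + X]big1 => [|s' /andP[_ es']]; last first.
  by rewrite [X in X * _]diff_coef_sub0 ?mul0r //= sub1set.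
rewrite addr0; under eq_bigl do rewrite -andbA.
rewrite sum_pairs_at // (bigD1 f) /=; last by rewrite fE nfe.
rewrite (bigD1 g) /=; last by rewrite gE nge eq_sym nfg.
rewrite big1 => [|h /andP[/andP[/andP[hE nhe] nhf] nhg]]; last first.
  rewrite [X in _ * X]diff_coef_sub0 ?mulr0 //= sfg.
  apply/negP => /subsetP/(_ h); rewrite !inE eqxx (negbTE nhe) (negbTE nhf) (negbTE nhg).
  by move=> /(_ isT).
have cs' : (#|G| <= #|components s| + 2)%N by rewrite cs.
have [tg _] := gen3_components sE s3 cs' gs; rewrite sDg in tg.
have [tf _] := gen3_components sE s3 cs' fs; rewrite sDf in tf.
rewrite addr0 !diff_coef12 //.
have -> : diff_coef le (state2 (f |: [set e])) (state2 s) = edge_sign le (f |: [set e]) g.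
  by rewrite sfg diff_coef23 ?tg // !inE negb_or eq_sym nfg.
have -> : diff_coef le (state2 (g |: [set e])) (state2 s) = edge_sign le (g |: [set e]) f.
  by rewrite sgf diff_coef23 ?tf // !inE negb_or nfg.
rewrite -(mem_touched f Kc) -(mem_touched g Kc) (touched_inner eE fE gE) ?tg // -!mulrA.
rewrite (edge_sign_swap le_order fE gE) ?inE // mulrN.
by rewrite addNr.
Qed.

End Complex.

Section Primitive.
Variables (G : sgraph) (le : rel {set G}).
Implicit Types (s : {set {set G}}) (e f K P : {set G}) (x y : G).
Local Notation J := (#|G|%:Z - 2).

Lemma dvd_row_mul_diff i k q (r : 'rV_#|gen G i J|) b : is_gen k J b ->
  dvdmx q (r *m diff_mx le i k J) ->
  (q %| \sum_(c | is_gen i J c) gen_fun (r 0%R) c * diff_coef le c b)%Z.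
Proof.
move=> /gen_index[y <-] /dvdmxP/(_ 0 y).
by rewrite row_mul_diff.
Qed.

Lemma dvd_gen_fun i q (r : 'rV_#|gen G i J|) :
  (forall b, is_gen i J b -> (q %| gen_fun (r 0%R) b)%Z) -> dvdmx q r.
Proof.
move=> h; apply/dvdmxP => a x; rewrite ord1 -gen_funE; apply: h.
exact: (valP (enum_val x)).
Qed.

Lemma residual_single P e x : x \notin e -> #|P| = 2 -> e \in edges G ->
  (P :&: e != set0) && ([set x] == residual P e) =
  [exists y in e, P == [set y; x]].
Proof.
move=> xe P2 eE; have e2 := card_edge eE; apply/andP/exists_inP => [[Pe]|[y ye /eqP ->]].
  rewrite /residual; case: (eqVneq P e) => [_ /eqP ex|nPe /eqP xP].
    by move: xe; rewrite -ex set11.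
  have [y] := set0Pn _ Pe; rewrite inE => /andP[yP ye]; exists y => //.
  have xP' : x \in P by have : x \in P :\: e; [rewrite -xP set11|rewrite inE => /andP[]].
  rewrite eq_sym eqEcard P2 subUset !sub1set yP xP' cards2.
  by rewrite (contraNneq _ xe) // => <-.
split; first by apply/set0Pn; exists y; rewrite !inE eqxx.
rewrite /residual ifN; last by apply: contraNneq xe => <-; rewrite !inE eqxx orbT.
apply/eqP/setP => z; rewrite !inE; have [->|nz] := eqVneq z x; first by rewrite xe orbT.
by rewrite orbF; have [->|] := eqVneq z y; rewrite ?ye ?andbF.
Qed.

(** The entry at [state1 e e] isolates the pair [e]; the one at [state1 [set x; y] [set z]] is the
    sum of the coordinates at the pairs [{x, z}] and [{y, z}]. With one vertex of a pair fixed,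
    divisibility thus travels along edges with the other. *)
Lemma primitive_diff01 : connected G -> primitive_mx (diff_mx le 0 1 J).
Proof.
move=> Gc q r qr; pose F P := gen_fun (r 0) (state0 P).
have sumF e K : e \in edges G -> K \in components [set e] ->
    (q %| \sum_(P : {set G} | (#|P| == 2)%N && ((P :&: e != set0) && (K == residual P e))) F P)%Z.
  move=> eE Kc; have : is_gen 1 J (state1 e K) by apply/is_gen1P; exists e, K.
  move=> /dvd_row_mul_diff/(_ qr); rewrite sum_gen0.
  rewrite big_mkcondr /= => h; apply: etrans h; congr (_ %| _)%Z.
  apply: eq_bigr => P /eqP P2; rewrite diff_coef01 // -/(residual P e) -/(F P).
  by case: ifP; rewrite ?mulr1 ?mulr0.
have Fedge e : e \in edges G -> (q %| F e)%Z.
  move=> eE; have [x [y [nxy exy]]] := edge_pair eE.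
  have ec : e \in components [set e].
    have xe : x \in e by rewrite exy !inE eqxx.
    by apply/componentsP; exists x; rewrite component_edge // xe.
  have := sumF e e eE ec; rewrite (big_pred1 e) // => P; rewrite /residual.
  rewrite [RHS]/=; case: (eqVneq P e) => [->|nPe].
    by rewrite card_edge // setIid !eqxx exy /= andbT; apply/set0Pn; exists x; rewrite !inE eqxx.
  apply/negbTE; rewrite !negb_and; apply/orP; right; rewrite -implybE; apply/implyP => /set0Pn[z].
  rewrite inE => /andP[zP ze]; apply/eqP => h; have := ze; rewrite {1}h inE ze.
  by [].
have Fpair x y z : adj x y -> z \notin [set x; y] -> (q %| F [set x; z] + F [set y; z])%Z.
  move=> xy ze; have eE : [set x; y] \in edges G by apply/edgesP; exists x, y.
  have zc : [set z] \in components [set [set x; y]].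
    by apply/componentsP; exists z; rewrite component_edge // (negbTE ze).
  have := sumF _ _ eE zc; have nxy := adj_neq xy.
  have [nzx nzy] : z != x /\ z != y by move: ze; rewrite !inE negb_or => /andP[].
  have nxz : [set x; z] != [set y; z].
    apply/eqP => /setP/(_ x); rewrite !inE eqxx (negbTE nxy) /=.
    by rewrite eq_sym (negbTE nzx).
  rewrite (eq_bigl (fun P => (P == [set x; z]) || (P == [set y; z]))); last first.
    move=> P; have [P2|nP2] := eqVneq #|P| 2%N; last first.
      by apply/esym/negbTE; rewrite negb_or; apply/andP; split; apply: contraNneq nP2 => ->;
        rewrite cards2 ?(eq_sym x z) ?(eq_sym y z) ?nzx ?nzy.
    rewrite residual_single //; apply/exists_inP/orP => [[u]|].
      by rewrite !inE => /orP[]/eqP ->; [left|right].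
    by case=> Pe; [exists x|exists y] => //; rewrite !inE eqxx ?orbT.
  rewrite (bigD1 [set x; z]) ?eqxx //= (big_pred1 [set y; z]) // => P.
  rewrite [RHS]/=; case: (eqVneq P [set y; z]) => [->|]; last by rewrite orbF andbN.
  by rewrite orbT eq_sym nxz.
apply: dvd_gen_fun => b /is_gen0P[P P2 ->].
have /eqP/cards2P[x [y [nxy ->]]] := P2.
(* The walk starts at [y] itself, where there is no pair; its first step away produces an edge. *)
pose Q u := (u == y) || (q %| F [set u; y])%Z.
suff : Q x by rewrite /Q (negbTE nxy).
apply: (@connected_invariant G Q Gc) (_ : Q y); last by rewrite /Q eqxx.
move=> u v uv; rewrite /Q => /orP[/eqP uy|qu].
  by rewrite Fedge ?orbT //; apply/edgesP; exists v, y; rewrite -uy adj_sym.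
have [//|nvy] := eqVneq v y; rewrite /=.
have [uy|nuy] := eqVneq u y.
  by rewrite Fedge //; apply/edgesP; exists v, y; rewrite -uy adj_sym.
rewrite -(addKr (F [set u; y]) (F [set v; y])) rpredD ?rpredN //.
by apply: Fpair => //; rewrite !inE negb_or ![y == _]eq_sym nuy.
Qed.

End Primitive.

(** * Edge triples of rank two and triangles *)

Section Triangles.
Variables (G : sgraph) (le : rel {set G}).
Implicit Types (s : {set {set G}}) (e f g K P A : {set G}) (x y : G).
Local Notation J := (#|G|%:Z - 2).

Definition pairs A : {set {set G}} := [set e : {set G} | e \subset A & #|e| == 2%N].

Lemma card_pairs A : #|A| = 3%N -> #|pairs A| = 3%N.
Proof. by move=> A3; rewrite cards_draws A3. Qed.

Lemma rank2_tripleP s : reflect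
  [/\ s \subset edges G, #|s| = 3%N & (#|components s| + 2)%N = #|G|] (rank2_triple s).
Proof. by apply: (iffP and3P) => -[sE /eqP s3 /eqP cs]. Qed.

Lemma rank2_triple_split s g : rank2_triple s -> g \in s ->
  exists e f, [/\ [/\ e \in edges G, f \in edges G & g \in edges G],
    [/\ f != e, g != e & g != f], s :\ g = [set f; e], s = g |: (f |: [set e])
    & #|touched (f |: [set e]) g| = 1%N].
Proof.
move=> /rank2_tripleP[sE s3 cs] gs.
have s2 : #|s :\ g| = 2%N by move: s3; rewrite (cardsD1 g) gs => -[].
have /eqP/cards2P[f [e [nfe efe]]] := s2; exists e, f.
have [es nge] : e \in s /\ e != g.
  by have : e \in s :\ g; [rewrite efe !inE eqxx orbT|rewrite in_setD1 => /andP[]].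
have [fs ngf] : f \in s /\ f != g.
  by have : f \in s :\ g; [rewrite efe !inE eqxx|rewrite in_setD1 => /andP[]].
have cs' : (#|G| <= #|components s| + 2)%N by rewrite cs.
have [tg _] := gen3_components sE s3 cs' gs; rewrite efe in tg.
split=> //; first by split; apply: (subsetP sE).
  by split=> //; rewrite eq_sym.
by rewrite -[f |: _]efe setD1K.
Qed.

(** A vertex outside [e] is a component by itself in the graph with the single edge [e]. *)
Lemma touched_sub e f g x : e \in edges G -> touched [set e] g = touched [set e] f ->
  x \in f -> x \notin e -> x \in g.
Proof.
move=> eE tfg xf xe; have : component [set e] x \in touched [set e] f.
  rewrite mem_touched ?component_components //; apply/set0Pn; exists x.
  by rewrite inE component_refl.
rewrite -tfg mem_touched ?component_components // component_edge // (negbTE xe).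
by case/set0Pn => y; rewrite !inE => /andP[/eqP ->].
Qed.

(** Relative to [e], the edges [f] and [g] have the same vertices outside [e]. There is exactly one,
    so the three edges are pairs from the three vertices of [b |: e], and they exhaust these pairs
    by number. *)
Lemma rank2_triple_pairs s : rank2_triple s -> #|cover s| = 3%N /\ s = pairs (cover s).
Proof.
move=> s3; have /rank2_tripleP[sE sc3 _] := s3.
have [g gs] : exists g, g \in s by apply/set0Pn; rewrite -card_gt0 sc3.
have [e [f [[eE fE gE] [nfe nge ngf] _ es tg]]] := rank2_triple_split s3 gs.
have tfg := touched_inner eE fE gE nfe nge (eq_leq tg).
have fg x := @touched_sub e f g x eE tfg.
have gf x := @touched_sub e g f x eE (esym tfg).
have [e2 f2 g2] : [/\ #|e| = 2, #|f| = 2 & #|g| = 2]%N by rewrite !card_edge.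
have [b bf be] : exists2 b, b \in f & b \notin e.
  by apply/subsetPn; apply: contra nfe => fe; rewrite eqEcard fe e2 f2.
have fe : f :\: e = [set b].
  apply/eqP; rewrite eq_sym eqEcard sub1set inE be bf cards1 /=.
  rewrite cardsD f2 leq_subLR addn1 ltnS card_gt0.
  (* If [f] were disjoint from [e], both its vertices would lie in [g], making [f] and [g] equal. *)
  apply/eqP => h; case/eqP: ngf; apply/esym/eqP; rewrite eqEcard f2 g2 leqnn andbT.
  apply/subsetP => x xf; apply: fg => //; apply/negP => xe.
  by have := in_set0 x; rewrite -h inE xf xe.
have cE : cover s = b |: e.
  apply/eqP; rewrite eqEsubset; apply/andP; split.
    apply/bigcupsP => h; rewrite es !inE => /or3P[]/eqP ->.
    - apply/subsetP => x xg; rewrite !inE; have [xe|xe] := boolP (x \in e).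
        by rewrite orbT.
      by have : x \in f :\: e; [rewrite inE xe gf|rewrite fe inE => ->].
    - apply/subsetP => x xf; rewrite !inE; have [xe|xe] := boolP (x \in e).
        by rewrite orbT.
      by have : x \in f :\: e; [rewrite inE xe xf|rewrite fe inE => ->].
    exact: subsetUr.
  rewrite subUset sub1set; apply/andP; split.
    by apply/bigcupP; exists f => //; rewrite es !inE eqxx orbT.
  by apply: (bigcup_max e) => //; rewrite es !inE eqxx !orbT.
have c3 : #|cover s| = 3%N by rewrite cE cardsU1 be e2.
split=> //; apply/eqP; rewrite eqEcard card_pairs // sc3 leqnn andbT.
apply/subsetP => h hs; rewrite inE card_edge ?(subsetP sE) // eqxx andbT.
exact: (bigcup_max h).
Qed.

Lemma triangle_rank2_triple A : A \in triangles G -> rank2_triple (pairs A) /\ cover (pairs A) = A.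
Proof.
rewrite inE => /andP[/eqP A3 /forall_inP adjA].
have pE : pairs A \subset edges G.
  apply/subsetP => e; rewrite inE => /andP[eA /cards2P[x [y [nxy exy]]]].
  have [xA yA] : x \in A /\ y \in A.
    by split; apply: (subsetP eA); rewrite exy !inE eqxx ?orbT.
  apply/edgesP; exists x, y; split=> //.
  by have /forall_inP/(_ y yA)/implyP := adjA x xA; apply.
have : (2 < #|A|)%N by rewrite A3.
case/card_gt2P => x [y [z [[xA yA zA] [nxy nyz nzx]]]].
have pP u v : u \in A -> v \in A -> u != v -> [set u; v] \in pairs A.
  by move=> uA vA nuv; rewrite inE cards2 nuv subUset !sub1set uA vA.
split; last first.
  apply/eqP; rewrite eqEsubset; apply/andP; split.
    by apply/bigcupsP => e; rewrite inE => /andP[].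
  have [nyx] : y != x by rewrite eq_sym.
  apply/subsetP => u uA; apply/bigcupP; have [ux|nux] := eqVneq u x.
    by exists [set x; y]; rewrite ?pP // ux !inE eqxx.
  by exists [set x; u]; rewrite ?pP // ?(eq_sym x u) // !inE eqxx orbT.
apply/rank2_tripleP; split; rewrite ?card_pairs //.
have gp := pP x z xA zA; rewrite eq_sym in nzx; have {}gp := gp nzx.
have gE := subsetP pE _ gp.
have s2 : #|pairs A :\ [set x; z]| = 2%N.
  by have := card_pairs A3; rewrite (cardsD1 [set x; z]) gp => -[].
have c2 := components_card2 (subset_trans (subsetDl _ _) pE) s2.
have := card_components_add (pairs A :\ [set x; z]) gE; rewrite setD1K // touched_pair.
suff -> : component (pairs A :\ [set x; z]) x = component (pairs A :\ [set x; z]) z.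
  by rewrite setUid cards1 addn1 => -[->]; rewrite addn2.
(* Without the edge [{x, z}], the vertices [x] and [z] are still joined through [y]. *)
apply/esym/component_eq; rewrite inE; apply: (@connect_trans _ _ y); apply: connect1.
  rewrite /span_adj nxy in_setD1 pP // andbT; apply/eqP => /setP/(_ y).
  by rewrite !inE eqxx orbT (eq_sym y x) (negbTE nxy) (negbTE nyz).
rewrite /span_adj nyz in_setD1 pP // andbT; apply/eqP => /setP/(_ y).
by rewrite !inE eqxx (eq_sym y x) (negbTE nxy) (negbTE nyz).
Qed.

Lemma card_rank2_triples : #|[set s : {set {set G}} | rank2_triple s]| = t3 G.
Proof.
apply: (card_eq_bij (f := @cover G)) => [s|s s'|A].
- rewrite inE => s3; have [c3 es] := rank2_triple_pairs s3; have /rank2_tripleP[sE _ _] := s3.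
  rewrite inE c3 eqxx /=; apply/forall_inP => x xA; apply/forall_inP => y yA.
  apply/implyP => nxy; apply: edge_adj => //; apply: (subsetP sE).
  by rewrite es inE cards2 nxy subUset !sub1set xA yA.
- by rewrite !inE => /rank2_triple_pairs[_ es] /rank2_triple_pairs[_ es'] cc; rewrite es cc -es'.
by move=> /triangle_rank2_triple[p3 cA]; exists (pairs A); rewrite ?inE.
Qed.

Lemma rank2_triple_eq s s' g : rank2_triple s -> rank2_triple s' -> g \in s -> s :\ g \subset s' -> s' = s.
Proof.
move=> s3 s'3 gs ss'; have [c3 ->] := rank2_triple_pairs s3; have [c3' ->] := rank2_triple_pairs s'3.
have [e [f [[eE fE gE] [nfe nge ngf] es _ _]]] := rank2_triple_split s3 gs.
congr pairs; have cf : (3 <= #|f :|: e|)%N.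
  rewrite ltnNge; apply: contra nfe => h.
  have ef : f :|: e = e by apply/esym/eqP; rewrite eqEcard subsetUr (card_edge eE).
  by rewrite eqEcard !card_edge // leqnn andbT -ef subsetUl.
have sub (t : {set {set G}}) : s :\ g \subset t -> f :|: e \subset cover t.
  rewrite es => /subsetP h; rewrite subUset.
  by rewrite (bigcup_max f) ?(bigcup_max e) // h // !inE eqxx ?orbT.
have e1 : f :|: e = cover s by apply/eqP; rewrite eqEcard sub ?subsetDl // c3.
have e2 : f :|: e = cover s' by apply/eqP; rewrite eqEcard sub // c3'.
by rewrite -e1 -e2.
Qed.

(** Removing an edge from a triangle leaves two edges contained in no other triangle, so the
    corresponding coordinate is isolated, with coefficient 1 or -1. *)
Lemma primitive_diff23_tr : primitive_mx (diff_mx le 2 3 J)^T.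
Proof.
move=> q r qr; apply: dvd_gen_fun => b /is_gen3P[s [sE s3 cs ->]].
have sg : rank2_triple s by apply/rank2_tripleP.
have [g gs] : exists g, g \in s by apply/set0Pn; rewrite -card_gt0 s3.
have [e [f [[eE fE gE] [nfe nge ngf] es es' tg]]] := rank2_triple_split sg gs.
have [|y ey] := @gen_index G 2 (state2 (s :\ g)).
  apply/is_gen2P; exists (s :\ g); rewrite es cards2 nfe; split=> //.
  by rewrite subUset !sub1set fE.
have /dvdmxP/(_ 0 y) := qr; rewrite mxE.
under eq_bigr do rewrite !mxE ey -(gen_funE (r 0)).
rewrite (sum_gen 3 (fun b => gen_fun (r 0) b * diff_coef le (state2 (s :\ g)) b)) sum_gen3.
rewrite (bigD1 s) //= big1 ?addr0 => [|s' /andP[s'3 ns']]; last first.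
  rewrite diff_coef_sub0 ?mulr0 //=; apply: contra ns' => ss'.
  exact/eqP/(rank2_triple_eq sg s'3 gs).
have -> : diff_coef le (state2 (s :\ g)) (state2 s) = edge_sign le (f |: [set e]) g.
  by rewrite es es' diff_coef23 ?tg // !inE negb_or ngf.
rewrite /edge_sign mulrC -signr_odd.
by case: (odd _); rewrite ?expr1 ?expr0 ?mul1r // mulN1r rpredN.
Qed.

End Triangles.

Section Cards.
Variable G : sgraph.
Implicit Types (s : {set {set G}}) (e f g K P A : {set G}) (x y : G).
Local Notation J := (#|G|%:Z - 2).

Lemma card_gen i : #|gen G i J| = (\sum_(b : state G | is_gen i J b) 1)%N.
Proof. by rewrite -sum1_card; exact: (sum_sig (is_gen (G := G) i J) (fun=> 1%N)). Qed.

Lemma card_gen0 : #|gen G 0 J| = 'C(#|G|, 2).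
Proof.
rewrite card_gen; apply: etrans (sum_gen0 (fun=> 1%N)) _.
rewrite -cardsT -(cards_draws [set: G] 2) -sum1_card.
by apply: eq_bigl => P; rewrite inE subsetT.
Qed.

Lemma card_gen1 : #|gen G 1 J| = (#|edges G| * #|G|.-1)%N.
Proof.
rewrite card_gen; apply: etrans (sum_gen1 (fun=> 1%N)) _.
rewrite -sum_nat_const; apply: eq_bigr => e eE.
rewrite -(card_components1 eE) /= -sum1_card.
by [].
Qed.

Lemma card_gen2 : #|gen G 2 J| = 'C(#|edges G|, 2).
Proof.
rewrite card_gen; apply: etrans (sum_gen2 (fun=> 1%N)) _.
rewrite -(cards_draws (edges G) 2) -sum1_card.
by apply: eq_bigl => P; rewrite inE.
Qed.

Lemma card_gen3 : #|gen G 3 J| = t3 G.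
Proof.
rewrite card_gen; apply: etrans (sum_gen3 (fun=> 1%N)) _.
rewrite -card_rank2_triples -sum1_card.
by apply: eq_bigl => P; rewrite inE.
Qed.

End Cards.

(** * The transposed kernel of the middle map as a set of alternating forms *)

Section KernelForms.
Variables (G : sgraph) (le : rel {set G}).
Hypothesis le_order : linear_order_on (edges G) le.
Variables (n : nat) (vo : 'I_(1 + n) -> G) (vi : G -> 'I_(1 + n)).
Hypotheses (voK : cancel vo vi) (viK : cancel vi vo).
Local Notation m := #|edges G|.
Local Notation J := (#|G|%:Z - 2).
Variables (a b : 'I_m -> 'I_(1 + n)).
Hypothesis adj_ab : forall i, adj (vo (a i)) (vo (b i)).
Hypothesis edge_ab : forall i, enum_val i = [set vo (a i); vo (b i)].
Implicit Types (e f K : {set G}).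

Lemma edge_neq_ab i : a i != b i.
Proof. by apply: contraTneq (adj_ab i) => ->; rewrite adj_irrefl. Qed.

Variable R : finComNzRingType.
Local Notation n2 := #|gen G 2 J|.

(** The sign turns a coordinate indexed by unordered pairs of edges into an antisymmetric function
    of ordered pairs. *)
Definition edge_form (y : 'cV[R]_n2) f e : R :=
  if f == e then 0 else (edge_sign le [set e] f)%:~R * gen_fun (y ^~ 0) (state2 (f |: [set e])).

Definition form_mx (y : 'cV[R]_n2) : 'M[R]_m :=
  \matrix_(i, k) edge_form y (enum_val i) (enum_val k).

Lemma edge_form_swap y f e : e \in edges G -> f \in edges G -> edge_form y e f = - edge_form y f e.
Proof.
move=> eE fE; rewrite /edge_form eq_sym; case: eqVneq => [_|nfe]; first by rewrite oppr0.
by rewrite (edge_sign1_swap le_order eE fE) 1?eq_sym // rmorphN mulNr [e |: _]setUC.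
Qed.

Lemma form_mx_alternating y : alternating (form_mx y).
Proof.
apply/andP; split; last by apply/forallP => i; rewrite mxE /edge_form eqxx.
by apply/eqP/matrixP => i k; rewrite !mxE edge_form_swap ?enum_valP.
Qed.

Lemma form_mx_inj : injective form_mx.
Proof.
move=> y z /matrixP yz; apply/colP => x.
have /is_gen2P[s [sE s2 es]] := valP (enum_val x).
have /eqP/cards2P[f [e [nfe sfe]]] := s2.
have eE : e \in edges G by apply: (subsetP sE); rewrite sfe !inE eqxx orbT.
have fE : f \in edges G by apply: (subsetP sE); rewrite sfe !inE eqxx.
have := yz (enum_rank_in eE f) (enum_rank_in eE e).
rewrite !mxE /edge_form !enum_rankK_in // (negbTE nfe) -sfe -es !gen_funE.
by rewrite /edge_sign rmorphXn rmorphN1 => /(can_inj (signrMK _)).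
Qed.

(** By counting: [form_mx] is injective between finite sets that both have [#|R| ^ 'C(m, 2)]
    elements. *)
Lemma form_mx_surj w : alternating w -> exists y, form_mx y = w.
Proof.
move=> aw; have : form_mx @: [set: 'cV[R]_n2] = [set w | alternating w].
  have c : #|form_mx @: [set: 'cV[R]_n2]| = (#|R| ^ 'C(m, 2))%N.
    by rewrite card_imset ?cardsT ?card_mx ?muln1 ?card_gen2 //; apply: form_mx_inj.
  apply/eqP; rewrite eqEcard card_alternating c leqnn andbT.
  by apply/subsetP => _ /imsetP[y _ ->]; rewrite inE form_mx_alternating.
by move/setP/(_ w); rewrite inE aw => /imsetP[y _ ->]; exists y.
Qed.

Definition meet_sum y e K : R := \sum_(f in edges G) (K :&: f != set0)%:R * edge_form y f e.

Lemma kernel_diff12 (y : 'cV[R]_n2) :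
  map_mx intr (diff_mx le 1 2 J) *m y = 0 <->
  forall e K, e \in edges G -> K \in components [set e] -> meet_sum y e K = 0.
Proof.
have E e K : e \in edges G -> K \in components [set e] ->
   \sum_(c | is_gen 2 J c) (diff_coef le (state1 e K) c)%:~R * gen_fun (y ^~ 0) c = meet_sum y e K.
  move=> eE Kc; rewrite sum_gen2 (bigID (fun s : {set {set G}} => e \in s)) /=.
  rewrite addrC big1 ?add0r => [|s /andP[_ es]].
    under eq_bigl do rewrite -andbA.
    have z : edge_form y e e = 0 by rewrite /edge_form eqxx.
    rewrite sum_pairs_at // /meet_sum [RHS](bigD1 e) //= z mulr0 add0r.
    apply: eq_bigr => f /andP[fE nfe]; rewrite diff_coef12 // /edge_form (negbTE nfe).
    by rewrite rmorphM /= rmorph_nat mulrA.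
  by rewrite diff_coef_sub0 ?mul0r //= sub1set.
have F x : (map_mx intr (diff_mx le 1 2 J) *m y) x 0 =
   \sum_(c | is_gen 2 J c) (diff_coef le (val (enum_val x)) c)%:~R * gen_fun (y ^~ 0) c.
  rewrite mxE -(sum_gen 2 (fun c => (diff_coef le (val (enum_val x)) c)%:~R * gen_fun (y ^~ 0) c)).
  by apply: eq_bigr => z _; rewrite !mxE gen_funE.
split=> [/colP y0 e K eE Kc|h].
  have [|x ex] := @gen_index G 1 (state1 e K); first by apply/is_gen1P; exists e, K.
  by have := y0 x; rewrite F ex E // mxE.
apply/colP => x; rewrite F mxE; have /is_gen1P[e [K [eE Kc ->]]] := valP (enum_val x).
by rewrite E // h.
Qed.

Lemma meet_sum_unsigned y u k :
  (unsigned_inc a b R *m form_mx y) u k = meet_sum y (enum_val k) [set vo u].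
Proof.
rewrite mxE /meet_sum [RHS]big_enum_val.
apply: eq_bigr => i _; rewrite !mxE; congr (_ * _).
rewrite setI_eq0 disjoints1 negbK edge_ab !inE !(can_eq voK).
have := edge_neq_ab i; have [->|_] := eqVneq u (a i); last by rewrite add0r.
by move=> /negbTE ->; rewrite addr0.
Qed.

(** An edge other than [enum_val k] contains at most one of its ends, and the edge itself
    contributes 0 as the form is alternating. *)
Lemma meet_sum_edge y k : meet_sum y (enum_val k) (enum_val k) =
  meet_sum y (enum_val k) [set vo (a k)] + meet_sum y (enum_val k) [set vo (b k)].
Proof.
rewrite /meet_sum -big_split /=; apply: eq_bigr => f fE; rewrite -mulrDl.
have [->|nfk] := eqVneq f (enum_val k); first by rewrite /edge_form eqxx !mulr0.
congr (_ * _); rewrite !setI_eq0 !disjoints1 !negbK.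
have nab : vo (a k) != vo (b k) by rewrite (can_eq voK) edge_neq_ab.
have -> : [disjoint enum_val k & f] = ~~ ((vo (a k) \in f) || (vo (b k) \in f)).
  rewrite edge_ab -setI_eq0 negb_or; apply/eqP/andP => [/setP h|[na nb]].
    by have := h (vo (a k)); have := h (vo (b k)); rewrite !inE !eqxx orbT /= => -> ->.
  apply/setP => x; rewrite !inE; apply/negP => /andP[/orP[]/eqP ->]; exact/negP.
rewrite negbK; have : ~~ ((vo (a k) \in f) && (vo (b k) \in f)).
  apply: contra nfk => /andP[ak bk]; rewrite eq_sym eqEcard !card_edge ?enum_valP // leqnn andbT.
  by rewrite edge_ab subUset !sub1set ak.
by do 2!case: (_ \in f); rewrite //= ?addr0 ?add0r.
Qed.

Lemma kernel_inc_forms y :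
  map_mx intr (diff_mx le 1 2 J) *m y = 0 <-> form_mx y \in inc_forms a b R.
Proof.
rewrite kernel_diff12; split=> [h|].
  apply/inc_formsP; first exact: edge_neq_ab.
  split; first exact: form_mx_alternating.
  apply/matrixP => u k; rewrite mul_mx_diag [RHS]mxE !meet_sum_unsigned [signed_inc _ _ _ _ _]mxE.
  rewrite /inc_flow [X in _ * X]mxE meet_sum_unsigned.
  have kE := enum_valP k; have ak : vo (a k) \in enum_val k by rewrite edge_ab !inE eqxx.
  (* In the graph with the single edge [k], the component of [a k] is that edge; its equation makes
     the values at the two ends opposite, which is the column of [I diag(l)]. *)
  have := h _ _ kE (component_components [set enum_val k] (vo (a k))).
  rewrite component_edge // ak meet_sum_edge => /eqP.
  rewrite addr_eq0 => /eqP ab; have nab := edge_neq_ab k.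
  have [->|nua] := eqVneq u (a k); first by rewrite (negbTE nab) subr0 mul1r.
  have [->|nub] := eqVneq u (b k); first by rewrite sub0r mulN1r ab opprK.
  rewrite subrr mul0r h // -(_ : component [set enum_val k] (vo u) = [set vo u]).
    exact: component_components.
  by rewrite component_edge // edge_ab !inE !(can_eq voK) (negbTE nua) (negbTE nub).
move=> /(inc_formsP edge_neq_ab)[_ /matrixP D] e K eE Kc.
pose k := enum_rank_in eE e; have ek : enum_val k = e by rewrite enum_rankK_in.
have Dk u : meet_sum y e [set vo u] =
    ((u == a k)%:R - (u == b k)%:R) * inc_flow a b (form_mx y) 0 k.
  by rewrite -ek -meet_sum_unsigned D mul_mx_diag mxE [signed_inc _ _ _ _ _]mxE.
have nab := edge_neq_ab k; have /componentsP[x ->] := Kc; rewrite component_edge //.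
case: ifP => xe; last first.
  rewrite -(viK x) Dk; have : x \notin e by rewrite xe.
  rewrite -ek edge_ab !inE -{1 2}(viK x) !(can_eq voK) negb_or => /andP[/negbTE -> /negbTE ->].
  by rewrite subrr mul0r.
rewrite -{2}ek -[in LHS]ek meet_sum_edge ek !Dk !eqxx (negbTE nab) eq_sym (negbTE nab).
by rewrite subr0 sub0r mul1r mulN1r subrr.
Qed.

Lemma card_kernel_diff12 :
  #|[set y : 'cV[R]_n2 | map_mx intr (diff_mx le 1 2 J) *m y == 0]| = #|inc_forms a b R|.
Proof.
apply: (card_eq_bij (f := form_mx)) => [y|y z _ _|w].
- by rewrite inE => /eqP/kernel_inc_forms.
- exact: form_mx_inj.
move=> wI; have [aw _] := inc_formsP edge_neq_ab w wI.
have [y yw] := form_mx_surj aw; exists y => //.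
by rewrite inE; apply/eqP/kernel_inc_forms; rewrite yw.
Qed.

End KernelForms.

(** * Assembling the isomorphisms *)

Lemma zmod_iso_trans (U V W : zmodType) : zmod_iso U V -> zmod_iso V W -> zmod_iso U W.
Proof.
move=> [f bf] [g bg]; exists (g \o f : {additive U -> W}).
exact: bij_comp bg bf.
Qed.

Lemma zmod_iso_zmod_morphism (U V : zmodType) (f : U -> V) :
  zmod_morphism f -> bijective f -> zmod_iso U V.
Proof.
move=> fB bf; exists (HB.pack_for {additive U -> V} f (GRing.isZmodMorphism.Build _ _ f fB)).
exact: bf.
Qed.

Lemma zmod_iso_rV1 : zmod_iso 'rV[int]_1 int.
Proof.
apply: (@zmod_iso_zmod_morphism _ _ (fun r : 'rV[int]_1 => r 0 0)) => [x y|].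
  by rewrite !mxE.
exists (fun x : int => x%:M) => [r|x]; last by rewrite mxE.
by rewrite -mx11_scalar.
Qed.

Lemma zmod_iso_prodr (U V W : zmodType) : zmod_iso V W -> zmod_iso (U * V)%type (U * W)%type.
Proof.
move=> [f [g fK gK]].
apply: (@zmod_iso_zmod_morphism _ _ (fun x : U * V => (x.1, f x.2))) => [x y|].
  by rewrite /= raddfB.
by exists (fun x : U * W => (x.1, g x.2)) => -[u v] /=; rewrite ?fK ?gK.
Qed.

Lemma zmod_iso_prod_rV0 (U : zmodType) : zmod_iso (U * 'rV[int]_0)%type U.
Proof.
apply: (@zmod_iso_zmod_morphism _ _ (fun x : U * 'rV[int]_0 => x.1)) => [x y //|].
by exists (fun u : U => (u, 0)) => [[u r]|//]; rewrite [r]thinmx0.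
Qed.

(** For [n + 1] vertices and [p + n] edges this is the rank equation of [homologies_of_Smith] with
    [b = C(p, 2)] and [h = 0]; the extra 1 in [b] for an odd cycle becomes [h = 1]. *)
Lemma bin_rank_identity n p : ((p + n) * n + 'C(p, 2) = 'C(p + n, 2) + 'C(n.+1, 2))%N.
Proof.
elim: p => [|p IH].
  by elim: n => // n IH; rewrite !add0n !binS !bin1 !bin0 in IH *; lia.
by rewrite addSn !binS !bin1 mulSn; rewrite binS bin1 in IH; lia.
Qed.

Section Homologies.
Variables (G : sgraph) (le : rel {set G}).
Hypothesis le_order : linear_order_on (edges G) le.
Hypothesis Gconn : connected G.
Local Notation J := (#|G|%:Z - 2).

(** The numerical hypothesis is the Euler characteristic and amounts to [s1 = C(v, 2) + h].
    Transposing the complex exchanges the roles of degrees 1 and 2, so the same [a] gives the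
    torsion of [H^2] and of [H_1]. *)
Lemma homologies_of_Smith r s1 a b h :
  Smith_form (diff_mx le 1 2 J) r s1 b a ->
  #|gen G 1 J| = (r + s1)%N -> #|gen G 2 J| = (r + b)%N ->
  (#|edges G| * #|G|.-1 + b = 'C(#|edges G|, 2) + 'C(#|G|, 2) + h)%N ->
  [/\ zmod_iso (chomology le 1 J) ('rV['Z_2]_a * 'rV[int]_h)%type,
      exists2 k, (k + t3 G = b)%N & zmod_iso (chomology le 2 J) 'rV[int]_k,
      zmod_iso (cohomology le 1 J) 'rV[int]_h
    & exists2 k, (k + t3 G = b)%N &
        zmod_iso (cohomology le 2 J) ('rV['Z_2]_a * 'rV[int]_k)%type].
Proof.
move=> SB n1E n2E bE; have pA := @primitive_diff01 G le Gconn.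
have pC := @primitive_diff23_tr G le.
have AB := diff01_diff12 le_order; have BC := diff12_diff23 le_order.
have s1E h' : s1 = (#|gen G 0 J| + h')%N -> h' = h.
  rewrite card_gen0 => e; move: n1E n2E; rewrite card_gen1 card_gen2; lia.
have pA' : primitive_mx (diff_mx le 0 1 J)^T^T by rewrite trmxK.
have AB' : (diff_mx le 1 2 J)^T *m (diff_mx le 0 1 J)^T = 0 by rewrite -trmx_mul AB trmx0.
have BC' : (diff_mx le 2 3 J)^T *m (diff_mx le 1 2 J)^T = 0 by rewrite -trmx_mul BC trmx0.
split.
- have [h' [/s1E -> H]] :=
    row_homology_torsion (C := (diff_mx le 0 1 J)^T) (Smith_form_tr SB) pA' AB'.
  exact: chomology_rows H _ _.
- have [k [bk H]] := row_homology_free (A := (diff_mx le 2 3 J)^T) (Smith_form_tr SB) pC BC'.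
  exists k; first by rewrite bk card_gen3 addnC.
  exact: chomology_rows H _ _.
- have [h' [/s1E -> H]] := row_homology_free SB pA AB.
  exact: cohomology_rows H _ _.
have [k [bk H]] := row_homology_torsion SB pC BC.
exists k; first by rewrite bk card_gen3 addnC.
exact: cohomology_rows H _ _.
Qed.

Lemma homologies_of_counts a b h :
  (forall N, prime N || (N == 4) ->
    #|[set y : 'cV['Z_N]_#|gen G 2 J| | map_mx intr (diff_mx le 1 2 J) *m y == 0]|
       = (N ^ b * num_ann N 2 ^ a)%N) ->
  (#|edges G| * #|G|.-1 + b = 'C(#|edges G|, 2) + 'C(#|G|, 2) + h)%N ->
  [/\ zmod_iso (chomology le 1 J) ('rV['Z_2]_a * 'rV[int]_h)%type,
      exists2 k, (k + t3 G = b)%N & zmod_iso (chomology le 2 J) 'rV[int]_k,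
      zmod_iso (cohomology le 1 J) 'rV[int]_h
    & exists2 k, (k + t3 G = b)%N &
        zmod_iso (cohomology le 2 J) ('rV['Z_2]_a * 'rV[int]_k)%type].
Proof.
move=> /Smith_of_counts[r [s1 [L [L' [M [M' [P [P' [N [N' [d]]]]]]]]]]].
case=> -[e1 e2 eB] cL cP d12 da; apply: (@homologies_of_Smith r s1) => //.
by exists L, L', M, M', P, P', N, N', d.
Qed.

Lemma adj_of_edge (x y u v : G) : [set x; y] = [set u; v] -> x != y ->
  (x = u /\ y = v) \/ (x = v /\ y = u).
Proof.
move=> e nxy; have : x \in [set u; v] by rewrite -e !inE eqxx.
have : y \in [set u; v] by rewrite -e !inE eqxx orbT.
rewrite !inE => /orP[]/eqP ey /orP[]/eqP ex; move: nxy; rewrite ex ey ?eqxx //; by [left|right].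
Qed.

(** Modulo [q], [Y] changes sign along each edge, so going once around an odd cycle gives [2 Y = 0]
    at a vertex of it; connectedness carries this to all vertices. *)
Lemma odd_cycle_dvd (q : int) (Y : G -> int) : has_odd_cycle G ->
  (forall x y, adj x y -> (q %| Y x + Y y)%Z) -> forall x, (q %| 2 * Y x)%Z.
Proof.
move=> [c /andP[_ /andP[cyc _]] odd_c] qY.
have walk (p : seq G) (x : G) : path (@adj G) x p -> (q %| Y x - (-1) ^+ size p * Y (last x p))%Z.
  elim: p x => [|y p IH] x /=; first by rewrite mul1r subrr.
  case/andP=> /qY xy /IH yp; rewrite exprS mulN1r mulNr opprK.
  have -> : Y x + (-1) ^+ size p * Y (last y p) =
      Y x + Y y - (Y y - (-1) ^+ size p * Y (last y p)) by ring.
  exact: rpredB.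
case: c cyc odd_c => // x p /= xp odd_p.
have qx : (q %| 2 * Y x)%Z.
  have := walk _ _ xp; rewrite last_rcons size_rcons -signr_odd /= odd_p expr1 mulN1r opprK.
  by rewrite mulr_natl mulr2n.
move=> y; apply: (@connected_invariant G (fun z => (q %| 2 * Y z)%Z) Gconn _ x y qx) => u v uv qu.
rewrite -(addKr (2 * Y u) (2 * Y v)) rpredD ?rpredN // -mulrDr.
by apply: dvdz_mull; apply: qY.
Qed.

Lemma homologies : let p := p1 G in
  (bipartite G -> [/\ zmod_iso (chomology le 1 J) ('rV['Z_2]_p * 'rV[int]_0)%type,
      exists2 k, (k + t3 G = 'C(p, 2))%N & zmod_iso (chomology le 2 J) 'rV[int]_k,
      zmod_iso (cohomology le 1 J) 'rV[int]_0
    & exists2 k, (k + t3 G = 'C(p, 2))%N &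
        zmod_iso (cohomology le 2 J) ('rV['Z_2]_p * 'rV[int]_k)%type]) /\
  (has_odd_cycle G -> [/\ zmod_iso (chomology le 1 J) ('rV['Z_2]_(p - 1) * 'rV[int]_1)%type,
      exists2 k, (k + t3 G = 'C(p, 2) + 1)%N & zmod_iso (chomology le 2 J) 'rV[int]_k,
      zmod_iso (cohomology le 1 J) 'rV[int]_1
    & exists2 k, (k + t3 G = 'C(p, 2) + 1)%N &
        zmod_iso (cohomology le 2 J) ('rV['Z_2]_(p - 1) * 'rV[int]_k)%type]).
Proof.
have [n Gn] : exists n, #|G| = (1 + n)%N.
  exists #|G|.-1; rewrite add1n prednK //; apply/card_gt0P.
  have /eqP/cards1P[K eK] := Gconn.
  have /componentsP[x _] : K \in components (edges G) by rewrite eK set11.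
  by exists x.
pose vi (x : G) : 'I_(1 + n) := cast_ord Gn (enum_rank x).
pose vo (i : 'I_(1 + n)) : G := enum_val (cast_ord (esym Gn) i).
have viK : cancel vi vo by move=> x; rewrite /vo /vi cast_ordK enum_rankK.
have voK : cancel vo vi by move=> i; rewrite /vo /vi enum_valK cast_ordKV.
have ends (i : 'I_#|edges G|) : exists p : 'I_(1 + n) * 'I_(1 + n),
    adj (vo p.1) (vo p.2) /\ enum_val i = [set vo p.1; vo p.2].
  have /edgesP[x [y [xy e]]] := enum_valP i.
  by exists (vi x, vi y); rewrite /= !viK.
have [ab /all_and2[ab_adj ab_edge]] := fin_all_exists ends.
pose a i := (ab i).1; pose b i := (ab i).2.
have adj_ab i : adj (vo (a i)) (vo (b i)) := ab_adj i.
have edge_ab i : enum_val i = [set vo (a i); vo (b i)] := ab_edge i.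
have nab := edge_neq_ab adj_ab.
have adj_index x y : adj x y -> exists k,
    (x = vo (a k) /\ y = vo (b k)) \/ (x = vo (b k) /\ y = vo (a k)).
  move=> xy; have eE : [set x; y] \in edges G by apply/edgesP; exists x, y.
  have := edge_ab (enum_rank_in eE [set x; y]); rewrite enum_rankK_in //.
  by move=> /adj_of_edge/(_ (adj_neq xy)) ?; eexists; eassumption.
have conn (Q : pred 'I_(1 + n)) : (forall e, Q (a e) = Q (b e)) -> forall u v, Q u -> Q v.
  move=> Qab u v Qu; rewrite -(voK v).
  apply: (@connected_invariant G (fun x => Q (vi x)) Gconn _ (vo u)); last by rewrite voK.
  move=> x y /adj_index[k [[-> ->]|[-> ->]]]; by rewrite !voK Qab.
have kerE N : #|[set y : 'cV['Z_N]_#|gen G 2 J| | map_mx intr (diff_mx le 1 2 J) *m y == 0]|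
    = #|inc_forms a b 'Z_N|.
  exact: (card_kernel_diff12 le_order voK viK adj_ab edge_ab 'Z_N).
have pE : p1 G = (#|edges G| - n)%N.
  by rewrite /p1 Gconn Gn addn1 add1n subSS.
have ltn := leq_rank_edges conn.
have rkE := bin_rank_identity n (p1 G); rewrite pE subnK // in rkE.
have N1 N : prime N || (N == 4) -> (1 < N)%N by case/orP => [/prime_gt1|/eqP ->].
rewrite /= pE; split=> [[c cc]|odd].
  apply: homologies_of_counts => [N hN|]; last by rewrite Gn /= addn0.
  rewrite kerE (card_inc_forms_bipartite nab conn _ (c := c \o vo)) ?card_Z_N ?N1 //.
  by move=> e; apply: cc.
have okern q (y : 'rV[int]_(1 + n)) : dvdmx q (y *m unsigned_inc a b int) ->
    forall u, (q %| 2 * y 0%R u)%Z.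
  move=> /dvdmxP qy u; rewrite -(voK u).
  apply: (odd_cycle_dvd (Y := fun x => y 0 (vi x)) odd) => x x' xx'.
  have [k hk] := adj_index x x' xx'; have := qy 0 k; rewrite mul_unsigned.
  by case: hk => -[-> ->]; rewrite !voK // addrC.
apply: homologies_of_counts => [N hN|].
  rewrite kerE; have [_ ->] := card_inc_forms_odd nab conn N okern.
  by rewrite card_Z_N ?N1.
by rewrite Gn add1n /= addnA rkE.
Qed.

End Homologies.

Theorem theorem3p2 (G : sgraph) (le : rel {set G})
    (le_order : linear_order_on (edges G) le) (Gconn : connected G) :
  let v : int := #|G|%:Z in
  [/\ (bipartite G ->
         zmod_iso (chomology le 1 (v - 2)) 'rV['Z_2]_(p1 G)) /\
      (has_odd_cycle G ->
         zmod_iso (chomology le 1 (v - 2)) ('rV['Z_2]_(p1 G - 1) * int)%type),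
      (bipartite G ->
         exists2 r : nat, (r + t3 G = 'C(p1 G, 2))%N &
           zmod_iso (chomology le 2 (v - 2)) 'rV[int]_r) /\
      (has_odd_cycle G ->
         exists2 r : nat, (r + t3 G = 'C(p1 G, 2) + 1)%N &
           zmod_iso (chomology le 2 (v - 2)) 'rV[int]_r),
      (bipartite G -> forall h : cohomology le 1 (v - 2), h = 0) /\
      (has_odd_cycle G -> zmod_iso (cohomology le 1 (v - 2)) int)
    & (bipartite G ->
         exists2 r : nat, (r + t3 G = 'C(p1 G, 2))%N &
           zmod_iso (cohomology le 2 (v - 2))
                    ('rV['Z_2]_(p1 G) * 'rV[int]_r)%type) /\
      (has_odd_cycle G ->
         exists2 r : nat, (r + t3 G = 'C(p1 G, 2) + 1)%N &
           zmod_iso (cohomology le 2 (v - 2))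
                    ('rV['Z_2]_(p1 G - 1) * 'rV[int]_r)%type)].
Proof.
move=> v; have [bip odd] := homologies le_order Gconn.
split; split.
- by move=> /bip[h _ _ _]; apply: zmod_iso_trans h (zmod_iso_prod_rV0 _).
- by move=> /odd[h _ _ _]; apply: zmod_iso_trans h (zmod_iso_prodr _ zmod_iso_rV1).
- by case/bip.
- by case/odd.
- move=> /bip[_ _ [f [g fK _]] _] h.
  by apply: (can_inj fK); rewrite [LHS]thinmx0 [RHS]thinmx0.
- by move=> /odd[_ _ h _]; apply: zmod_iso_trans h zmod_iso_rV1.
- by case/bip.
by case/odd.
Qed.
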